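(* Every polynomial solution $\varphi\in\mathbb R[\mu_1,\mu_2,\mu_3]$, of degree at most $5$, of the toric nearly Kähler equation $$\det\operatorname{Hess}\varphi=\left(\tfrac83-\tfrac{11}3\partial_r+\partial_r^2\right)\varphi,\qquad \partial_r=\sum_{i=1}^3\mu_i\frac{\partial}{\partial\mu_i},$$ is equivalent, up to coordinate transformation, to the cubic solution $$\varphi_0=3+\sum_{j=1}^3\mu_j^2+\frac1{\sqrt3}\,\mu_1\mu_2\mu_3 .$$
   Context: Here $\mu=(\mu_1,\mu_2,\mu_3)$ are linear coordinates on $\Lambda^2\mathfrak t^*\cong\mathbb R^3$, where $\mathfrak t\cong\mathbb R^3$ is the Lie algebra of a $3$-torus. $\operatorname{Hess}\varphi$ is the $3\times3$ matrix of second partial derivatives of $\varphi$ in these coordinates, and $\partial_r$ is the Euler vector field. The toric nearly Kähler equation is the Monge-Ampère type equation that locally describes toric nearly Kähler $6$-manifolds, that is, strictly nearly Kähler $6$-manifolds whose structure is invariant under an effective action of a $3$-torus. In this description $\mu$ is given by the multi-moment map with values in $\Lambda^2\mathfrak t^*$. The solution $\varphi_0$ corresponds to the homogeneous nearly Kähler structure on $\mathbb S^3\times\mathbb S^3$. Coordinate transformations are linear changes of the coordinates $\mu$. The function $\varphi$ takes values in $(\Lambda^3\mathfrak t^* )^{\otimes2}$, so it is rescaled accordingly. The homogeneous degree-one part of a solution is treated as a free choice and may be taken to be $0$. Thus $\varphi$ is equivalent to $\varphi_0$ if $\varphi(\mu)=|\det A|^{-1}\varphi_0(A\mu)+\ell(\mu)$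 for some $A\in\mathrm{GL}(3,\mathbb R)$ and some homogeneous linear function $\ell:\mathbb R^3\to\mathbb R$. These transformations preserve the equation.
   Formalization: As stated the claim fails: φ=0, φ=μ1μ2μ3/√3 and −φ0 solve the equation but are not equivalent to φ0; the theorem adds the hypothesis that Hess φ is positive definite at some point, which every polynomial equivalent to φ0 satisfies. *)

(* Defs.v *)
From HB Require Import structures.
From mathcomp Require Import all_boot all_order all_algebra.
From mathcomp Require Import reals.
From mathcomp Require Import mpoly.

Set Implicit Arguments.
Unset Strict Implicit.
Unset Printing Implicit Defensive.

Import Order.TTheory GRing.Theory Num.Theory.

Local Open Scope ring_scope.

Section ToricNearlyKahler.
Variable R : realType.
Implicit Types (phi psi : {mpoly R[3]}) (A : 'M[R]_3) (mu : 'I_3 -> R).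

Definition hess phi : 'M[{mpoly R[3]}]_3 :=
  \matrix_(i < 3, j < 3) mderiv j (mderiv i phi).

Definition euler phi : {mpoly R[3]} := \sum_(i < 3) 'X_i * mderiv i phi.

Definition toric_NK_equation phi : Prop :=
  \det (hess phi) =
    (8%:R / 3%:R) *: phi - (11%:R / 3%:R) *: euler phi + euler (euler phi).

Definition hess_at phi mu : 'M[R]_3 := map_mx (meval mu) (hess phi).

(* Where phi describes a toric nearly Kaehler structure, Hess phi is the Gram
   matrix of the generators of the torus action, hence positive definite.  The
   equation itself does not see this: for all real a, b, c the polynomial
     3abc + a x^2 + b y^2 + c z^2 + xyz / sqrt 3
   solves it, as do 0 and all linear forms. *)
Definition hess_posdef_at phi mu : Prop :=
  forall v : 'cV[R]_3, v != 0 -> 0 < (v^T *m hess_at phi mu *m v) 0 0.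

(* The polynomial mu |-> psi (A mu). *)
Definition lin_subst A psi : {mpoly R[3]} :=
  psi \mPo [tuple \sum_(j < 3) A i j *: ('X_j : {mpoly R[3]}) | i < 3].

(* The factor 1 / |det A| is there because phi takes values in the square of
   Lambda^3 t^*, while mu takes values in Lambda^2 t^*.  The zero polynomial is
   1.-homog, so l = 0 is allowed. *)
Definition toric_NK_equiv phi psi : Prop :=
  exists (A : 'M[R]_3) (l : {mpoly R[3]}),
    [/\ A \in unitmx, l \is 1.-homog &
        phi = `|\det A|^-1 *: lin_subst A psi + l].

Definition phi0 : {mpoly R[3]} :=
  3%:R%:MP + \sum_(j < 3) 'X_j ^+ 2
    + (Num.sqrt 3%:R)^-1 *: \prod_(j < 3) 'X_j.

End ToricNearlyKahler.

Arguments phi0 R : clear implicits.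

(* Main.v *)
Require Import Defs.
From HB Require Import structures.
From Stdlib Require Import ZArith.
From mathcomp Require Import all_boot all_order all_algebra.
From mathcomp Require Import perm reals.
From mathcomp Require Import mpoly.
From mathcomp Require Import ssrZ ring lra zify.

Set Implicit Arguments.
Unset Strict Implicit.
Unset Printing Implicit Defensive.

Import Order.TTheory GRing.Theory Num.Theory.

Local Open Scope ring_scope.

(** Write c_u for the coefficient of phi at the exponent u.  The operator
    mu_i mu_j d_i d_j multiplies every monomial by an integer, so the coefficient of det Hess phi at m is the cubic form
      sum over u + v + w = m + (2,2,2) of weight(u,v,w) c_u c_v c_w
    with integer weights (det_hess_coef), while a monomial of degree n is an
    eigenvector of the operator on the right-hand side, with eigenvalue
    (n - 1)(n - 8/3).  The proof compares coefficients (NK_coef) in coordinates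
    that make most of them visibly zero.  Changes of coordinates are shears and
    transpositions; both have determinant 1 or -1, so phi o A is again a solution
    with somewhere positive definite Hessian (change_coords).

    1. A direction in which phi is quadratic.  If phi has degree d = 4 or 5, the
    Hessian of its leading form F has determinant zero because 3 (d - 2) > d.  As
    in the theorem of Gordan and Noether, F is then a cone: after a change of
    coordinates it depends on x and y only.  If F involves both x and y,
    the equation in the degrees just below 3 (d - 2) restricts how the lower
    forms involve z.  If F = A x^d, either the quartic part has the same effect,
    or a real zero of the cubic part in the plane x = 0 is taken as the
    z-direction; such a zero is all that is needed for d <= 3.  In each case phi
    ends up with no monomial x^i y^j z^k such that i + j + 2 k > 5 (quartic_standard,
    quintic_standard, standard_by_cubic_zero).

    2. Solutions quadratic in one variable.  Call that variable x, so that
    phi = P + x Q + x^2 S with P, Q, S in y and z, deg Q <= 3 and S affine.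
    If S is not constant, say S = n y + const, the equation forces
    2 i + j + 2 k <= 5 on all monomials; the part of phi divisible by y
    contains the quadratic form n x^2 + c_111 x z + c_012 z^2, whose discriminant
    comes out as 1/3 > 0.  An isotropic vector of it is a new x-direction, for which
    S is constant (quadratic_standard).  If S = s is constant, it is positive, as
    somewhere the Hessian is; the equation at x^2 says det Hess Q = - 1/3, and
    coordinates exist in which Q = b y^3 + k y z + const with k^2 = 1/3
    (const_standard, const_isotropic_standard).  The remaining equations exclude
    b <> 0, because they say that a positive definite quadratic form in b vanishes
    (no_cubic_part), and kill P except for its quadratic terms
    (const_normalised_standard).

    3. What is left, up to a linear form, is
      3 a b c + a x^2 + b y^2 + c z^2 + k x y z   with k^2 = 1/3,
    where a, b, c > 0 by positivity once more.  A diagonal change of coordinates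
    identifies it with phi0 (standard_normal_form). *)

(** * Exponents and coefficients in three variables *)
Definition ix : 'I_3 := ord0.
Definition iy : 'I_3 := lift ord0 ord0.
Definition iz : 'I_3 := lift ord0 (lift ord0 ord0).

Lemma ord3P (P : 'I_3 -> Prop) : P ix -> P iy -> P iz -> forall i, P i.
Proof.
move=> h0 h1 h2 [[|[|[|i]]] hi] //.
- by rewrite (_ : Ordinal hi = ix) //; apply: val_inj.
- by rewrite (_ : Ordinal hi = iy) //; apply: val_inj.
- by rewrite (_ : Ordinal hi = iz) //; apply: val_inj.
Qed.

Lemma big3 (V : nmodType) (F : 'I_3 -> V) : \sum_i F i = F ix + F iy + F iz.
Proof. by rewrite !big_ord_recl big_ord0 addr0 addrA. Qed.

Lemma det3 (K : comPzRingType) (M : 'M[K]_3) :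
  \det M = M ix ix * (M iy iy * M iz iz - M iy iz * M iz iy)
         - M ix iy * (M iy ix * M iz iz - M iy iz * M iz ix)
         + M ix iz * (M iy ix * M iz iy - M iy iy * M iz ix).
Proof.
have det2 (N : 'M[K]_2) : \det N = N 0 0 * N 1 1 - N 0 1 * N 1 0.
  rewrite (expand_det_row _ 0) !big_ord_recl big_ord0 addr0 /cofactor !det_mx11.
  rewrite !mxE /= expr0 expr1 !(mul1r, mulN1r, mulrN).
  by do !(congr (_ * _) || congr (_ - _) || congr (N _ _)); apply: val_inj.
rewrite (expand_det_row _ 0) big3 /cofactor !det2 !mxE /= expr0 expr1 expr2.
rewrite !(mul1r, mulN1r, mulrN, opprK).
by do !(congr (_ + _) || congr (_ * _) || congr (- _) || congr (M _ _)); apply: val_inj.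
Qed.

(** Exponents are triples of literals rather than multinomials, so that
    supports, shifts and weights can be computed. *)
Definition expo := (nat * nat * nat)%type.
Definition expo_nth (u : expo) (i : nat) : nat := nth 0%N [:: u.1.1; u.1.2; u.2] i.
Definition mon (u : expo) : 'X_{1..3} := [multinom expo_nth u i | i < 3].
Definition expo_add (u v : expo) : expo := (u.1.1 + v.1.1, u.1.2 + v.1.2, u.2 + v.2)%N.
Definition expo_deg (u : expo) : nat := (u.1.1 + u.1.2 + u.2)%N.

Definition low_expos : seq expo :=
  [seq u <- [seq (p, k) | p <- [seq (i, j) | i <- iota 0 6, j <- iota 0 6], k <- iota 0 6]
     | (expo_deg u <= 5)%N].

Arguments low_expos : simpl never.

Lemma mon_surj m : exists u, m = mon u.
Proof.
exists (m ix, m iy, m iz); apply/mnmP.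
by apply: ord3P; rewrite mnmE.
Qed.

Lemma mon_add u v : mon (expo_add u v) = (mon u + mon v)%MM.
Proof. by apply/mnmP; apply: ord3P; rewrite !mnmE. Qed.

Lemma mon_inj : injective mon.
Proof.
move=> [[a b] c] [[a' b'] c'] /mnmP E.
by have := E ix; have := E iy; have := E iz; rewrite !mnmE /expo_nth /= => -> -> ->.
Qed.

Lemma mdeg_mon u : mdeg (mon u) = expo_deg u.
Proof. by rewrite mdegE !big_ord_recl big_ord0 !mnmE /expo_deg /expo_nth /= addn0 addnA. Qed.

Lemma mem_low_expos u : (u \in low_expos) = (expo_deg u <= 5)%N.
Proof.
rewrite mem_filter andb_idr //; case: u => [[i j] k] h; have {}h : (i + j + k <= 5)%N := h.
have mem6 l : (l <= 5)%N -> l \in iota 0 6 by rewrite mem_iota.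
apply/allpairsPdep; exists (i, j), k; split=> //; last by apply: mem6; lia.
by apply/allpairsPdep; exists i, j; split=> //; apply: mem6; lia.
Qed.

Lemma low_expos_uniq : uniq low_expos.
Proof. by vm_compute. Qed.

Opaque low_expos.

Section Coefficients.
Variable R : realType.
Implicit Types (phi psi : {mpoly R[3]}) (P : pred expo).

Definition cf phi (u : expo) : R := phi@_(mon u).

Lemma cfE phi u : cf phi u = phi@_(mon u).
Proof. by []. Qed.

(** The coefficients vanish outside P and in degree above 5.  Knowledge about a
    solution is accumulated by shrinking P. *)
Definition supported phi P := forall u, ~~ ((expo_deg u <= 5)%N && P u) -> cf phi u = 0.

Lemma supported_sum phi P : supported phi P ->
  phi = \sum_(u <- [seq u <- low_expos | P u]) cf phi u *: 'X_[mon u].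
Proof.
move=> h; apply/mpolyP => m; have [u ->] := mon_surj m.
rewrite (big_morph _ (mcoeffD _) (mcoeff0 _ _)).
under eq_bigr => v _ do rewrite mcoeffZ mcoeffX (inj_eq mon_inj).
case: (boolP (u \in [seq u <- low_expos | P u])) => hu.
  rewrite (bigD1_seq u hu) ?filter_uniq ?low_expos_uniq //.
  rewrite /= eqxx mulr1 big1 ?addr0 // => v /negbTE ->.
  by rewrite mulr0.
rewrite big_seq big1; last first.
  by move=> v hv; case: eqP => [e|]; rewrite ?mulr0 //; rewrite -e hv in hu.
by apply: h; rewrite mem_filter mem_low_expos andbC in hu.
Qed.

(** Integer weights are binary, so that they can be computed. *)
Definition Zr (z : Z) : R := (int_of_Z z)%:~R.

Lemma ZrM a b : Zr (a * b)%Z = Zr a * Zr b.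
Proof. by rewrite /Zr -intrM -rmorphM. Qed.
Lemma ZrD a b : Zr (a + b)%Z = Zr a + Zr b.
Proof. by rewrite /Zr -intrD -raddfD. Qed.
Lemma ZrB a b : Zr (a - b)%Z = Zr a - Zr b.
Proof. by rewrite /Zr -intrB -raddfB. Qed.
Lemma Zr_nat n : Zr (Z.of_nat n) = n%:R.
Proof. by rewrite /Zr -[Z.of_nat n]/(Z_of_int n) Z_of_intK. Qed.

(** The eigenvalue of the operator mu_i mu_j d_i d_j on the monomial u. *)
Definition hess_int (u : expo) (i j : nat) : Z :=
  (Z.of_nat (expo_nth u i) * (Z.of_nat (expo_nth u j) - Z.of_nat (i == j)))%Z.

(** The determinant whose rows come from the exponents u, v and w; it is what
    three monomials contribute to the Hessian determinant. *)
Definition weight (u v w : expo) : Z :=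
  (hess_int u 0 0 * (hess_int v 1 1 * hess_int w 2 2 - hess_int v 1 2 * hess_int w 2 1)
 - hess_int u 0 1 * (hess_int v 1 0 * hess_int w 2 2 - hess_int v 1 2 * hess_int w 2 0)
 + hess_int u 0 2 * (hess_int v 1 0 * hess_int w 2 1 - hess_int v 1 1 * hess_int w 2 0))%Z.

Lemma hess_monomial (i j : 'I_3) u :
  'X_i * 'X_j * mderiv j (mderiv i 'X_[mon u]) = Zr (hess_int u i j) *: 'X_[mon u] :> {mpoly R[3]}.
Proof.
rewrite mderivX mderivZ mderivX scalerA mnmBE mnm1E !mnmE.
rewrite /hess_int ZrM ZrB !Zr_nat -(inj_eq val_inj) /=.
have [-> | ui_gt0] := posnP (expo_nth u i); first by rewrite !(mulr0n, mul0r, scale0r, mulr0).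
have le_d : ((i == j :> nat) <= expo_nth u j)%N by case: eqP => // <-.
rewrite -natrB //.
have [-> | uij_gt0] := posnP (expo_nth u j - (i == j :> nat))%N.
  by rewrite !(mulr0n, mulr0, scale0r).
rewrite -scalerAr -!mpolyXD submDA addmC submK //.
apply/mnm_lepP => l; rewrite mnmDE !mnm1E mnmE -!(inj_eq val_inj) /=.
move: ui_gt0 uij_gt0 le_d.
case: (i == l :> nat) / eqP => [<-|_]; case: (j == _ :> nat) / eqP => [<-|_] //=.
all: lia.
Qed.

End Coefficients.

(** * The coefficients of the equation *)
Section DetSum.
Variables (K : comPzRingType) (I : Type) (s : seq I).

Lemma triple_sum (a b c : I -> K) :
  (\sum_(u <- s) a u) * (\sum_(v <- s) b v) * (\sum_(w <- s) c w) =
  \sum_(u <- s) \sum_(v <- s) \sum_(w <- s) a u * b v * c w.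
Proof.
rewrite !mulr_suml; apply: eq_bigr => u _.
rewrite [a u * _]mulr_sumr mulr_suml; apply: eq_bigr => v _.
by rewrite mulr_sumr.
Qed.

Lemma det_sum (T : I -> 'I_3 -> 'I_3 -> K) :
  \det (\matrix_(i < 3, j < 3) \sum_(u <- s) T u i j) =
  \sum_(u <- s) \sum_(v <- s) \sum_(w <- s)
    (T u ix ix * (T v iy iy * T w iz iz - T v iy iz * T w iz iy)
   - T u ix iy * (T v iy ix * T w iz iz - T v iy iz * T w iz ix)
   + T u ix iz * (T v iy ix * T w iz iy - T v iy iy * T w iz ix)).
Proof.
rewrite det3 !mxE !mulrBr !mulrA !triple_sum.
rewrite -!sumrB -!big_split; apply: eq_bigr => u _ /=.
rewrite -!sumrB -!big_split; apply: eq_bigr => v _ /=.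
rewrite -!sumrB -!big_split; apply: eq_bigr => w _ /=.
by rewrite !mulrBr !mulrA; ring.
Qed.
End DetSum.

Section CoefEq.
Variable R : realType.
Implicit Types (phi psi : {mpoly R[3]}) (P : pred expo).

Lemma weightE u v w :
  Zr R (weight u v w) =
  let h v i j := Zr R (hess_int v i j) in
    h u 0 0 * (h v 1 1 * h w 2 2 - h v 1 2 * h w 2 1)
  - h u 0 1 * (h v 1 0 * h w 2 2 - h v 1 2 * h w 2 0)
  + h u 0 2 * (h v 1 0 * h w 2 1 - h v 1 1 * h w 2 0).
Proof.
rewrite /weight /=; move: (hess_int u 0 0) (hess_int u 0 1) (hess_int u 0 2) => u0 u1 u2.
move: (hess_int v 1 0) (hess_int v 1 1) (hess_int v 1 2) => v0 v1 v2.
move: (hess_int w 2 0) (hess_int w 2 1) (hess_int w 2 2) => w0 w1 w2.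
by rewrite ZrD ZrB !ZrM !ZrB !ZrM.
Qed.

Lemma euler_coef (p : {mpoly R[3]}) m : (euler p)@_m = (mdeg m)%:R * p@_m.
Proof.
have eulerD q1 q2 : euler (q1 + q2) = euler q1 + euler q2.
  by rewrite /euler -big_split; apply: eq_bigr => i _ /=; rewrite mderivD mulrDr.
have eulerX c m1 : euler (c *: 'X_[m1]) = (c * (mdeg m1)%:R) *: 'X_[m1] :> {mpoly R[3]}.
  rewrite mdegE natr_sum mulr_sumr scaler_suml; apply: eq_bigr => i _.
  rewrite mderivZ mderivX -!scalerAr scalerA.
  have [->|mi] := posnP (m1 i); first by rewrite mulr0n mulr0 !scale0r.
  by rewrite -mpolyXD addmC submK // lep1mP -lt0n.
elim/mpolyind: p => [|c m1 p _ _ ih].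
  by rewrite /euler big1 ?mcoeff0 ?mulr0 // => i _; rewrite mderiv0 mulr0.
rewrite eulerD !mcoeffD ih eulerX !mcoeffZ mcoeffX mulrDr.
by case: eqP => [->|_]; rewrite ?mulr0 // !mulr1 mulrC.
Qed.

(** Multiplied by (mu_1 mu_2 mu_3)^2, the Hessian determinant becomes the
    determinant of the matrix with entries mu_i mu_j d_i d_j phi, whose entries
    have the exponents of phi; it is expanded row by row. *)
Lemma det_hess_coef phi P m : supported phi P ->
  let S := [seq u <- low_expos | P u] in
  (\det (hess phi))@_(mon m) =
  \sum_(u <- S) \sum_(v <- S) \sum_(w <- S)
    (if expo_add (expo_add u v) w == expo_add m (2, 2, 2)%N then
     Zr R (weight u v w) * (cf phi u * cf phi v * cf phi w) else 0).
Proof.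
move=> hP S.
pose X3 : {mpoly R[3]} := 'X_[mon (2, 2, 2)%N].
have X3E : X3 = ('X_ix * 'X_iy * 'X_iz) ^+ 2.
  rewrite expr2 -!mpolyXD; congr ('X_[_]); apply/mnmP.
  by apply: ord3P; rewrite !(mnmE, mnmDE, mnm1E).
pose T u (i j : 'I_3) : {mpoly R[3]} := (cf phi u * Zr R (hess_int u i j)) *: 'X_[mon u].
have hT i j : \sum_(u <- S) T u i j = 'X_i * 'X_j * hess phi i j.
  rewrite mxE {1}(supported_sum hP).
  have dsum k (F : expo -> {mpoly R[3]}) (s : seq expo) :
      mderiv k (\sum_(u <- s) F u) = \sum_(u <- s) mderiv k (F u).
    exact: (big_morph _ (mderivD k) (mderiv0 _ k)).
  rewrite !dsum mulr_sumr.
  apply: eq_bigr => u _; rewrite !mderivZ -scalerAr hess_monomial scalerA.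
  by [].
have -> : (\det (hess phi))@_(mon m) =
    (\det (\matrix_(i < 3, j < 3) \sum_(u <- S) T u i j))@_(mon (expo_add m (2,2,2)%N)).
  rewrite mon_add addmC -[LHS](mcoeffMX _ (mon (2,2,2)%N)) -/X3 X3E.
  by rewrite addmC; congr (mcoeff _ _); rewrite [in RHS]det3 !mxE !hT det3; ring.
rewrite det_sum !(big_morph _ (mcoeffD _) (mcoeff0 _ _)).
apply: eq_bigr => u _; rewrite !(big_morph _ (mcoeffD _) (mcoeff0 _ _)).
apply: eq_bigr => v _; rewrite !(big_morph _ (mcoeffD _) (mcoeff0 _ _)).
apply: eq_bigr => w _.
pose X := 'X_[mon (expo_add (expo_add u v) w)] : {mpoly R[3]}.
have -> : T u ix ix * (T v iy iy * T w iz iz - T v iy iz * T w iz iy)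
   - T u ix iy * (T v iy ix * T w iz iz - T v iy iz * T w iz ix)
   + T u ix iz * (T v iy ix * T w iz iy - T v iy iy * T w iz ix)
   = (Zr R (weight u v w) * (cf phi u * cf phi v * cf phi w)) *: X.
  rewrite /X !mon_add !mpolyXD weightE /T -!mul_mpolyC /=.
  move: (Zr R (hess_int u 0 0)) (Zr R (hess_int u 0 1)) (Zr R (hess_int u 0 2)) => u0 u1 u2.
  move: (Zr R (hess_int v 1 0)) (Zr R (hess_int v 1 1)) (Zr R (hess_int v 1 2)) => v0 v1 v2.
  move: (Zr R (hess_int w 2 0)) (Zr R (hess_int w 2 1)) (Zr R (hess_int w 2 2)) => w0 w1 w2.
  move: (cf phi u) (cf phi v) (cf phi w) 'X_[mon u] 'X_[mon v] 'X_[mon w] => a b c x y z.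
  by rewrite !(mpolyCM, mpolyCD, mpolyCB); ring.
rewrite mcoeffZ mcoeffX (inj_eq mon_inj).
by case: eqP; rewrite ?mulr1 ?mulr0.
Qed.
End CoefEq.

#[global] Opaque cf.

(** * Computing the coefficients *)
(** A product of three coefficients; sorting makes equal products comparable. *)
Definition key := (expo * expo * expo)%type.

Definition expo_ltn (u v : expo) : bool :=
  ((u.1.1 * 36 + u.1.2 * 6 + u.2) < (v.1.1 * 36 + v.1.2 * 6 + v.2))%N.

Definition swap12 (k : key) : key := if expo_ltn k.1.1 k.1.2 then (k.1.2, k.1.1, k.2) else k.
Definition swap23 (k : key) : key := if expo_ltn k.1.2 k.2 then (k.1.1, k.2, k.1.2) else k.
Definition sort_key (k : key) : key := swap12 (swap23 (swap12 k)).

Fixpoint add_term (k : key) (z : Z) (l : seq (key * Z)) : seq (key * Z) :=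
  if l is (k', z') :: l' then
    if k == k' then (k', (z + z')%Z) :: l' else (k', z') :: add_term k z l'
  else [:: (k, z)].

(** The cubic form of det_hess_coef with like terms collected, as data that
    reduces to a short explicit list when P and m are concrete. *)
Definition hess_terms (P : pred expo) (m : expo) : seq (key * Z) :=
  let S := [seq u <- low_expos | P u] in
  let M := expo_add m (2, 2, 2)%N in
  [seq t <- foldr (fun u acc => foldr (fun v acc => foldr (fun w acc =>
      if expo_add (expo_add u v) w == M then add_term (sort_key (u, v, w)) (weight u v w) acc
      else acc) acc S) acc S) [::] S | t.2 != 0].

(** Zr in a form that unfolds to a term with binary digits, of a size that
    linear arithmetic can handle. *)
Fixpoint bin_pos (R : pzSemiRingType) (p : positive) : R :=
  match p with
  | xH => 1
  | xO p => 2 * bin_pos R p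
  | xI p => 1 + 2 * bin_pos R p
  end.
Definition bin_Z (R : pzRingType) (z : Z) : R :=
  match z with Z0 => 0 | Zpos p => bin_pos R p | Zneg p => - bin_pos R p end.

Section Terms.
Variable R : realType.
Implicit Types (phi psi : {mpoly R[3]}) (P : pred expo).

Definition val_key phi (k : key) : R := cf phi k.1.1 * cf phi k.1.2 * cf phi k.2.

Definition val_terms phi (l : seq (key * Z)) : R :=
  foldr (fun t acc => bin_Z R t.2 * val_key phi t.1 + acc) 0 l.

Lemma bin_ZE z : bin_Z R z = Zr R z.
Proof.
have posE p : bin_pos R p = (Pos.to_nat p)%:R.
  elim: p => [p ih|p ih|] //=.
    have -> : Pos.to_nat p~1 = (1 + 2 * Pos.to_nat p)%N by lia.
    by rewrite ih natrD natrM.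
  have -> : Pos.to_nat p~0 = (2 * Pos.to_nat p)%N by lia.
  by rewrite ih natrM.
case: z => [|p|p] //; first by rewrite /= posE /Zr /= pmulrn.
rewrite /= posE /Zr /= NegzE mulrNz -pmulrn; congr (- _%:R).
by have := Pos2Nat.is_pos p; lia.
Qed.

Lemma val_sort_key phi k : val_key phi (sort_key k) = val_key phi k.
Proof.
rewrite /sort_key; case: k => [[u v] w].
have e12 k : val_key phi (swap12 k) = val_key phi k.
  by rewrite /swap12 /val_key; case: expo_ltn; [rewrite [in LHS]/= [X in X * _]mulrC | ].
have e23 k : val_key phi (swap23 k) = val_key phi k.
  by rewrite /swap23 /val_key; case: expo_ltn; [rewrite [in LHS]/= mulrAC | ].
by rewrite e12 e23 e12.
Qed.

Lemma val_add_term phi k z l :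
  val_terms phi (add_term k z l) = Zr R z * val_key phi k + val_terms phi l.
Proof.
elim: l => [|[k' z'] l ih] /=; first by rewrite bin_ZE.
case: eqP => [->|_] /=; first by rewrite !bin_ZE ZrD mulrDl addrA.
by rewrite ih addrCA.
Qed.

Lemma val_terms_nz phi l : val_terms phi [seq t <- l | t.2 != 0] = val_terms phi l.
Proof.
elim: l => //= t l ih; case: eqP => [->|_] /=; rewrite ih //.
by rewrite mul0r add0r.
Qed.

Lemma val_foldr phi (F : expo -> seq (key * Z) -> seq (key * Z)) (G : expo -> R) s acc :
  (forall u acc, val_terms phi (F u acc) = G u + val_terms phi acc) ->
  val_terms phi (foldr F acc s) = \sum_(u <- s) G u + val_terms phi acc.
Proof.
move=> h; elim: s => [|u s ih] /=; first by rewrite big_nil add0r.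
by rewrite h ih big_cons addrA.
Qed.

Lemma val_terms_sum phi P m : let S := [seq u <- low_expos | P u] in
  val_terms phi (hess_terms P m) =
  \sum_(u <- S) \sum_(v <- S) \sum_(w <- S)
    (if expo_add (expo_add u v) w == expo_add m (2, 2, 2)%N then
     Zr R (weight u v w) * (cf phi u * cf phi v * cf phi w) else 0).
Proof.
rewrite /hess_terms val_terms_nz /=; set S := filter _ _.
rewrite -[RHS]addr0; apply: val_foldr => u acc; apply: val_foldr => v acc'.
apply: val_foldr => w acc''; case: ifP => _; last by rewrite add0r.
by rewrite val_add_term val_sort_key.
Qed.

Definition eigenvalue (m : expo) : R := ((expo_deg m)%:R - 1) * ((expo_deg m)%:R - 8 / 3).

Lemma NK_coef phi P m : toric_NK_equation phi -> supported phi P ->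
  val_terms phi (hess_terms P m) = eigenvalue m * cf phi m.
Proof.
move=> NK hP; rewrite val_terms_sum -det_hess_coef // NK.
rewrite mcoeffD mcoeffB !mcoeffZ !euler_coef mdeg_mon /eigenvalue -/(cf phi m).
by field.
Qed.

Lemma NK_coef_out phi P m : toric_NK_equation phi -> supported phi P ->
  ~~ ((expo_deg m <= 5)%N && P m) -> val_terms phi (hess_terms P m) = 0.
Proof. by move=> NK hP hm; rewrite (NK_coef m NK hP) (hP _ hm) mulr0. Qed.

Lemma supported_remove phi P u : supported phi P -> cf phi u = 0 ->
  supported phi (fun v => P v && (v != u)).
Proof.
move=> hP hu v; rewrite andbA negb_and => /orP[/hP//|].
by rewrite negbK => /eqP ->.
Qed.

End Terms.

(* Names e the equation at m, written out in the coefficients of phi; h is the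
   support of phi.  Outside the support the right-hand side is 0. *)
Ltac compare_coef NK hP m e :=
  first [ have e := NK_coef_out NK hP (m := m) isT
        | have e := NK_coef m NK hP ];
  match type of e with
  | context [hess_terms ?P ?u] =>
      let l := eval vm_compute in (hess_terms P u) in
      let h := fresh in
      assert (h : hess_terms P u = l) by (vm_cast_no_check (@Logic.eq_refl (seq (key * Z)) l));
      rewrite h in e; clear h
  end;
  cbv beta iota delta [val_terms val_key foldr bin_Z bin_pos fst snd] in e;
  rewrite ?/eigenvalue ?/expo_deg /= in e.

(* Arithmetic tactics would compare coefficients up to conversion, that is, by
   unfolding polynomials; they are given variables instead. *)
Ltac generalize_coefs :=
  repeat match goal with |- context [cf ?p ?u] => generalize (cf p u); intro end.

(* Solves x = y from an equation e that says a multiple of f * x = f * y, where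
   H : f != 0. *)
Ltac cancel_coef H e :=
  apply: (mulfI H); move: e; clear; generalize_coefs; lra.

(* Shows that the coefficient at u vanishes because the equation at m contains
   only its product with the factor that H states to be nonzero, and removes u
   from the support. *)
Ltac vanish NK h H u m :=
  let z := fresh "z" in let e := fresh "e" in
  match type of NK with toric_NK_equation ?phi =>
    have z : cf phi u = 0 by (compare_coef NK h m e; cancel_coef H e)
  end;
  have {}h := supported_remove h z; clear z.

(* The same when the equation contains the square of the coefficient. *)
Ltac vanish_square NK h H u m :=
  let z := fresh "z" in let e := fresh "e" in
  match type of NK with toric_NK_equation ?phi =>
    have z : cf phi u = 0 by (compare_coef NK h m e;
      apply/eqP; rewrite -sqrf_eq0; apply/eqP; cancel_coef H e)
  end;
  have {}h := supported_remove h z; clear z.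

(** * Linear changes of coordinates *)
Lemma mpoly_ring_ind n (R : comNzRingType) (Q : {mpoly R[n]} -> Prop) :
  (forall c, Q c%:MP) -> (forall i, Q 'X_i) ->
  (forall p q, Q p -> Q q -> Q (p + q)) -> (forall p q, Q p -> Q q -> Q (p * q)) ->
  forall p, Q p.
Proof.
move=> QC QX QD QM p; have Q0 : Q 0 by rewrite -mpolyC0; apply: QC.
have Q1 : Q 1 by rewrite -mpolyC1; apply: QC.
rewrite [p]mpolyE; apply: (big_ind Q Q0 QD) => m _.
rewrite -mul_mpolyC mpolyXE_id; apply: (QM _ _ (QC _)).
apply: (big_ind Q Q1 QM) => i _.
by elim: (m i) => [|k ih]; rewrite ?expr0 // exprS; apply: (QM _ _ (QX i)).
Qed.

Section LinSubst.
Variable R : realType.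
Implicit Types (phi psi p q : {mpoly R[3]}) (A B : 'M[R]_3).

Lemma lin_substC A c : lin_subst A c%:MP = c%:MP.
Proof. exact: comp_mpolyC. Qed.
Lemma lin_substX A i : lin_subst A 'X_i = \sum_j A i j *: 'X_j.
Proof. by rewrite /lin_subst comp_mpolyXU -tnth_nth tnth_mktuple. Qed.
Lemma lin_substD A p q : lin_subst A (p + q) = lin_subst A p + lin_subst A q.
Proof. exact: comp_mpolyD. Qed.
Lemma lin_substM A p q : lin_subst A (p * q) = lin_subst A p * lin_subst A q.
Proof. exact: rmorphM. Qed.
Lemma lin_substZ A c p : lin_subst A (c *: p) = c *: lin_subst A p.
Proof. exact: comp_mpolyZ. Qed.
Lemma lin_substB A p q : lin_subst A (p - q) = lin_subst A p - lin_subst A q.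
Proof. exact: comp_mpolyB. Qed.
Lemma lin_subst_sum A I (s : seq I) (F : I -> {mpoly R[3]}) :
  lin_subst A (\sum_(i <- s) F i) = \sum_(i <- s) lin_subst A (F i).
Proof. exact: raddf_sum. Qed.

Lemma lin_subst_comp A B p : lin_subst A (lin_subst B p) = lin_subst (B *m A) p.
Proof.
elim/mpoly_ring_ind: p => [c|i|p q hp hq|p q hp hq].
- by rewrite !lin_substC.
- rewrite !lin_substX lin_subst_sum.
  under eq_bigr => j _ do rewrite lin_substZ lin_substX scaler_sumr.
  rewrite exchange_big; apply: eq_bigr => k _ /=.
  by rewrite mxE scaler_suml; apply: eq_bigr => j _; rewrite scalerA.
- by rewrite !lin_substD hp hq.
- by rewrite !lin_substM hp hq.
Qed.

Lemma lin_subst1 p : lin_subst 1%:M p = p.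
Proof.
rewrite -[RHS]comp_mpoly_id /lin_subst; congr (_ \mPo _).
apply: eq_mktuple => i; rewrite (bigD1 i) //= mxE eqxx scale1r big1 ?addr0 // => j.
by rewrite mxE eq_sym => /negbTE ->; rewrite scale0r.
Qed.

Lemma mderiv_lin_subst A p j :
  mderiv j (lin_subst A p) = \sum_i A i j *: lin_subst A (mderiv i p).
Proof.
elim/mpoly_ring_ind: p => [c|i|p q hp hq|p q hp hq].
- rewrite lin_substC mderivC big1 // => i _.
  by rewrite mderivC -mpolyC0 lin_substC mpolyC0 scaler0.
- have mderivXU k l : mderiv k 'X_l = (k == l)%:R :> {mpoly R[3]}.
    rewrite mderivX mnm1E eq_sym; case: eqP => [->|_]; last by rewrite scale0r.
    by rewrite -[X in (X - _)%MM](add0m U_(l)%MM) addmK scale1r mpolyX0.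
  rewrite lin_substX (big_morph _ (mderivD _) (mderiv0 _ _)).
  under eq_bigr => k _ do rewrite mderivZ mderivXU.
  under [RHS]eq_bigr => k _ do rewrite mderivXU -mpolyC_nat lin_substC mpolyC_nat.
  rewrite (bigD1 j) //= eqxx big1 ?addr0; last first.
    by move=> k; rewrite eq_sym => /negbTE ->; rewrite scaler0.
  rewrite (bigD1 i) //= eqxx big1 ?addr0 // => k /negbTE ->.
  by rewrite scaler0.
- rewrite lin_substD mderivD hp hq -big_split; apply: eq_bigr => i _ /=.
  by rewrite mderivD lin_substD scalerDr.
- rewrite lin_substM mderivM hp hq mulr_suml mulr_sumr -big_split.
  apply: eq_bigr => i _ /=.
  by rewrite mderivM lin_substD !lin_substM scalerDr -scalerAl -scalerAr.
Qed.

Lemma hess_lin_subst A p :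
  hess (lin_subst A p) =
  (map_mx (@mpolyC 3 R) A)^T *m map_mx (lin_subst A) (hess p) *m map_mx (@mpolyC 3 R) A.
Proof.
apply/matrixP => i j; rewrite !mxE mderiv_lin_subst.
rewrite (big_morph _ (mderivD _) (mderiv0 _ _)).
under eq_bigr => k _ do rewrite mderivZ mderiv_lin_subst scaler_sumr.
rewrite exchange_big; apply: eq_bigr => l _; rewrite !mxE mulr_suml.
by apply: eq_bigr => k _; rewrite !mxE -!mul_mpolyC; ring.
Qed.

Lemma euler_lin_subst A p : euler (lin_subst A p) = lin_subst A (euler p).
Proof.
rewrite /euler lin_subst_sum.
under eq_bigr => i _ do rewrite mderiv_lin_subst mulr_sumr.
rewrite exchange_big; apply: eq_bigr => j _ /=.
rewrite lin_substM lin_substX mulr_suml; apply: eq_bigr => i _.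
by rewrite -scalerAr -scalerAl.
Qed.

Lemma meval_lin_subst A p mu :
  (lin_subst A p).@[mu] = p.@[fun i => \sum_j A i j * mu j].
Proof.
rewrite comp_mpoly_meval; apply: meval_eq => i.
rewrite tnth_mktuple (big_morph _ (mevalD _) (meval0 _)).
by apply: eq_bigr => j _; rewrite mevalZ mevalXU.
Qed.

(** The hypotheses and the conclusion of the theorem, both invariant under
    unimodular substitutions. *)
Definition admissible phi := toric_NK_equation phi /\ exists mu, hess_posdef_at phi mu.
Definition standard phi := toric_NK_equiv phi (phi0 R).

Definition unimodular A := `|\det A| = 1.

Lemma unimodular_unit A : unimodular A -> A \in unitmx.
Proof. by move=> h; rewrite unitmxE unitfE -normr_gt0 h. Qed.

Lemma NK_lin_subst A phi : unimodular A ->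
  toric_NK_equation phi -> toric_NK_equation (lin_subst A phi).
Proof.
move=> hA NK; rewrite /toric_NK_equation hess_lin_subst !det_mulmx det_tr.
have -> : \det (map_mx (lin_subst A) (hess phi)) = lin_subst A (\det (hess phi)).
  exact: (det_map_mx (comp_mpoly _)).
rewrite det_map_mx NK !euler_lin_subst lin_substD lin_substB !lin_substZ.
have dA : \det A * \det A = 1 by rewrite -expr2 -real_normK ?num_real // hA expr1n.
by rewrite mulrAC -mpolyCM dA mpolyC1 mul1r.
Qed.

Lemma posdef_lin_subst A phi : unimodular A ->
  (exists mu, hess_posdef_at phi mu) -> exists mu, hess_posdef_at (lin_subst A phi) mu.
Proof.
move=> hA [mu pos]; have uA := unimodular_unit hA.
exists (fun i => (invmx A *m \col_i mu i) i 0) => v v0.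
have -> : hess_at (lin_subst A phi) (fun i => (invmx A *m \col_i mu i) i 0) =
    A^T *m hess_at phi mu *m A.
  rewrite /hess_at hess_lin_subst !map_mxM -map_trmx -!map_mx_comp.
  have idA : map_mx (meval (fun i => (invmx A *m \col_i mu i) i 0) \o @mpolyC 3 R) A = A.
    by apply/matrixP => i j; rewrite mxE /= mevalC.
  rewrite !idA; congr (_ *m _ *m _).
  apply/matrixP => i j; rewrite !mxE /= meval_lin_subst; apply: meval_eq => k.
  have /(congr1 (fun M : 'cV_3 => M k 0)) := mulKVmx uA (\col_i mu i).
  by rewrite !mxE.
have := pos (A *m v); rewrite trmx_mul !mulmxA; apply.
apply: contra v0 => /eqP/(congr1 (mulmx (invmx A))).
by rewrite mulKmx // mulmx0 => ->.
Qed.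

Lemma admissible_lin_subst A phi : unimodular A ->
  admissible phi -> admissible (lin_subst A phi).
Proof. by move=> hA [? ?]; split; [apply: NK_lin_subst | apply: posdef_lin_subst]. Qed.

Lemma homog1_lin_subst A p : p \is 1.-homog -> lin_subst A p \is 1.-homog.
Proof.
move=> /dhomogP hp; rewrite [p]mpolyE lin_subst_sum big_seq.
apply: rpred_sum => m /hp /eqP /mdeg1P[i /eqP ->].
rewrite lin_substZ lin_substX; apply: dhomogZ; apply: rpred_sum => j _.
by apply: dhomogZ; rewrite dhomogX /= mdeg1.
Qed.

Lemma standard_lin_subst A phi : unimodular A -> standard (lin_subst A phi) -> standard phi.
Proof.
move=> hA [B [l [uB hl e]]]; have uA := unimodular_unit hA.
exists (B *m invmx A), (lin_subst (invmx A) l); split.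
- by rewrite unitmx_mul uB unitmx_inv.
- exact: homog1_lin_subst.
have := congr1 (lin_subst (invmx A)) e.
rewrite lin_substD lin_substZ !lin_subst_comp mulmxV // lin_subst1 => ->.
by rewrite det_mulmx det_inv normrM normfV hA invr1 mulr1.
Qed.

(** All later changes of coordinates go through this statement: to show that
    phi is equivalent to phi0, replace phi by phi o A. *)
Lemma change_coords A phi : unimodular A -> admissible phi ->
  (admissible (lin_subst A phi) -> standard (lin_subst A phi)) -> standard phi.
Proof.
by move=> hA adm h; apply: (standard_lin_subst hA); apply/h/admissible_lin_subst.
Qed.

End LinSubst.

(** * Shears and transpositions *)
Section Shears.
Variable R : realType.
Implicit Types (phi psi p q : {mpoly R[3]}).

Definition shear (a b : 'I_3) (s : R) : 'M[R]_3 := 1%:M + s *: delta_mx a b.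

Lemma unimodular_shear a b s : a != b -> unimodular (shear a b s).
Proof.
move=> ab; rewrite /unimodular; suff -> : \det (shear a b s) = 1 by rewrite normr1.
have diag i : shear a b s i i = 1.
  rewrite !mxE eqxx; case: eqP => [->|] /=; last by rewrite mulr0 addr0.
  by rewrite (negbTE ab) mulr0 addr0.
have offd i j : i != j -> ~~ ((i == a) && (j == b)) -> shear a b s i j = 0.
  by move=> /negbTE ij /negbTE nab; rewrite !mxE ij nab mulr0 addr0.
case: (ltnP a b) => [lt_ab|le_ba].
  have trig : is_trig_mx (shear a b s)^T.
    apply/is_trig_mxP => i j lt_ij; rewrite mxE offd //.
      by rewrite eq_sym -(inj_eq val_inj) ltn_eqF.
    by apply/negP => /andP[/eqP ja /eqP ib]; move: lt_ij lt_ab; rewrite ja ib; lia.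
  by rewrite -det_tr (det_trig trig) big1 // => i _; rewrite mxE diag.
have trig : is_trig_mx (shear a b s).
  apply/is_trig_mxP => i j lt_ij; rewrite offd //; first by rewrite -(inj_eq val_inj) ltn_eqF.
  by apply/negP => /andP[/eqP ia /eqP jb]; move: lt_ij le_ba; rewrite ia jb; lia.
by rewrite (det_trig trig) big1 // => i _; rewrite diag.
Qed.

Lemma lin_subst_shearX a b s i :
  lin_subst (shear a b s) 'X_i = 'X_i + (if i == a then s *: 'X_b else 0).
Proof.
rewrite lin_substX.
under eq_bigr => j _ do rewrite !mxE scalerDl.
rewrite big_split /=; congr (_ + _).
  rewrite (bigD1 i) //= eqxx scale1r big1 ?addr0 // => j.
  by rewrite eq_sym => /negbTE ->; rewrite scale0r.
case: eqP => _ /=; last by apply: big1 => j _; rewrite mulr0 scale0r.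
rewrite (bigD1 b) //= eqxx mulr1 big1 ?addr0 // => j /negbTE ->.
by rewrite mulr0 scale0r.
Qed.

(** The binomial theorem: X^m arises from X^(m + l e_a - e_b l) by choosing
    s X_b in l of the m_a + l factors X_a. *)
Lemma shear_coef a b s phi m : a != b ->
  (lin_subst (shear a b s) phi)@_m =
  \sum_(l < (m b).+1) (s ^+ l *+ 'C(m a + l, l)) * phi@_(m + U_(a) *+ l - U_(b) *+ l)%MM.
Proof.
move=> ab; rewrite {1}[phi]mpolyE lin_subst_sum (big_morph _ (mcoeffD _) (mcoeff0 _ _)).
pose c (u : 'X_{1..3}) : R := (lin_subst (shear a b s) 'X_[u])@_m.
under eq_bigr => u _ do rewrite lin_substZ mcoeffZ.
under [RHS]eq_bigr => l _.
  rewrite {1}[phi]mpolyE (big_morph _ (mcoeffD _) (mcoeff0 _ _)) mulr_sumr.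
  under eq_bigr => u _ do rewrite mcoeffZ mcoeffX mulrCA.
  over.
rewrite exchange_big; apply: eq_bigr => u _ /=; rewrite -mulr_sumr; congr (_ * _).
have -> : lin_subst (shear a b s) 'X_[u] =
    \sum_(l < (u a).+1) (s ^+ l *+ 'C(u a, l)) *: 'X_[u - U_(a) *+ l + U_(b) *+ l].
  rewrite mpolyXE_id.
  have -> : lin_subst (shear a b s) (\prod_(i < 3) 'X_i ^+ u i) =
     \prod_(i < 3) (lin_subst (shear a b s) 'X_i) ^+ u i.
    rewrite /lin_subst rmorph_prod; apply: eq_bigr => i _; exact: rmorphXn.
  rewrite (bigD1 a) //= lin_subst_shearX eqxx exprDn mulr_suml.
  apply: eq_bigr => l _.
  have la : (l <= u a)%N by rewrite -ltnS.
  have -> : \prod_(i < 3 | i != a) lin_subst (shear a b s) 'X_i ^+ u i =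
      \prod_(i < 3 | i != a) 'X_i ^+ u i.
    by apply: eq_bigr => i ia; rewrite lin_subst_shearX (negbTE ia) addr0.
  have -> : 'X_[u - U_(a) *+ l + U_(b) *+ l] =
      'X_a ^+ (u a - l) * (\prod_(i < 3 | i != a) 'X_i ^+ u i) * 'X_b ^+ l :> {mpoly R[3]}.
    rewrite mpolyXD -mpolyXn; congr (_ * _); rewrite mpolyXE_id (bigD1 a) //=.
    congr (_ * _); first by rewrite mnmBE mulmnE mnm1E eqxx mul1n.
    apply: eq_bigr => i ia; rewrite mnmBE mulmnE mnm1E eq_sym (negbTE ia) mul0n subn0 //.
  by rewrite exprZn -scalerAr scalerMnl -scalerAl mulrAC.
rewrite (big_morph _ (mcoeffD _) (mcoeff0 _ _)).
pose N := (u a + m b).+1.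
rewrite [LHS](big_ord_widen N
  (fun l => ((s ^+ l *+ 'C(u a, l)) *: 'X_[u - U_(a) *+ l + U_(b) *+ l])@_m)); last by rewrite /N; lia.
rewrite [RHS](big_ord_widen N
  (fun l => (s ^+ l *+ 'C(m a + l, l)) * (u == m + U_(a) *+ l - U_(b) *+ l)%MM%:R)); last by rewrite /N; lia.
rewrite big_mkcond [RHS]big_mkcond; apply: eq_bigr => l _ /=.
rewrite mcoeffZ mcoeffX !ltnS.
have -> : (if (l <= u a)%N then
    s ^+ l *+ 'C(u a, l) * ((u - U_(a) *+ l + U_(b) *+ l)%MM == m)%:R else 0)
  = (s ^+ l *+ 'C(u a, l)) * ((l <= u a)%N && ((u - U_(a) *+ l + U_(b) *+ l)%MM == m))%:R :> R.
  by case: leqP; rewrite ?mulr0.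
have -> : (if (l <= m b)%N then
    s ^+ l *+ 'C(m a + l, l) * (u == (m + U_(a) *+ l - U_(b) *+ l)%MM)%:R else 0)
  = (s ^+ l *+ 'C(m a + l, l)) *
    ((l <= m b)%N && (u == (m + U_(a) *+ l - U_(b) *+ l)%MM))%:R :> R.
  by case: leqP; rewrite ?mulr0.
have -> : (l <= m b)%N && (u == (m + U_(a) *+ l - U_(b) *+ l)%MM) =
          (l <= u a)%N && ((u - U_(a) *+ l + U_(b) *+ l)%MM == m).
  have ba : b == a = false by rewrite eq_sym; apply/negbTE.
  have evL i : ((u - U_(a) *+ l + U_(b) *+ l)%MM i = u i - (a == i) * l + (b == i) * l)%N.
    by rewrite mnmDE mnmBE !mulmnE !mnm1E.
  have evR i : ((m + U_(a) *+ l - U_(b) *+ l)%MM i = m i + (a == i) * l - (b == i) * l)%N.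
    by rewrite mnmBE mnmDE !mulmnE !mnm1E.
  apply/andP/andP => -[le_l /eqP/mnmP e]; split.
  - by have := e a; rewrite evR ba eqxx; lia.
  - apply/eqP/mnmP => i; have := e i; rewrite evL evR => ->.
    by case: (b =P i) le_l => [<-|_]; rewrite ?(negbTE ab); lia.
  - by have := e b; rewrite evL (negbTE ab) eqxx; lia.
  - apply/eqP/mnmP => i; have := e i; rewrite evL evR => <-.
    by case: (a =P i) le_l => [<-|_]; rewrite ?ba; lia.
case: andP => [[le_l /eqP/mnmP e]|_]; last by rewrite !mulr0.
have := e a; rewrite mnmDE mnmBE !mulmnE !mnm1E eqxx eq_sym (negbTE ab) mul1n mul0n addn0 => ea.
by have -> : (m a + l = u a)%N by lia.
Qed.

End Shears.

Definition shift_expo (a b l : nat) (u : expo) : expo :=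
  let f c := (expo_nth u c + (c == a) * l - (c == b) * l)%N in (f 0, f 1, f 2)%N.

Definition swap_expo (a b : nat) (u : expo) : expo :=
  let f c := expo_nth u (if c == a then b else if c == b then a else c)%N in (f 0, f 1, f 2)%N.

Section Coordinates.
Variable R : realType.
Implicit Types (phi psi : {mpoly R[3]}) (P : pred expo) (Q : nat -> nat -> bool).

Lemma cf_shear (a b : 'I_3) s phi u : a != b ->
  cf (lin_subst (shear a b s) phi) u =
  \sum_(l < (expo_nth u b).+1) (s ^+ l *+ 'C(expo_nth u a + l, l)) * cf phi (shift_expo a b l u).
Proof.
move=> ab; rewrite [LHS](shear_coef _ _ _ ab) !mnmE; apply: eq_bigr => l _.
congr (_ * (mcoeff _ _)); apply/mnmP; apply: ord3P;
  by rewrite mnmBE mnmDE !mulmnE !mnm1E !mnmE /expo_nth /= eq_sym [b == _]eq_sym -!(inj_eq val_inj).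
Qed.

Lemma supported_shear (a b : 'I_3) s phi P : a != b -> supported phi P ->
  (forall u l, (l <= expo_nth u b)%N -> P (shift_expo a b l u) -> P u) ->
  supported (lin_subst (shear a b s) phi) P.
Proof.
move=> ab hP cl u hu; rewrite cf_shear // big1 // => l _.
have lb : (l <= expo_nth u b)%N by rewrite -ltnS.
rewrite hP ?mulr0 //; apply: contra hu => /andP[du /(cl _ _ lb) -> ]; rewrite andbT.
apply: leq_trans du; move: (l : nat) lb => {}l.
case: u => [[i j] k]; rewrite /expo_deg /shift_expo /expo_nth /=.
by move: (a : nat) (b : nat) (ltn_ord a) (ltn_ord b) (ab : a != b :> nat)
  => [|[|[|//]]] [|[|[|//]]] //=; lia.
Qed.

Lemma cf_swap (a b : 'I_3) phi u :
  cf (lin_subst (tperm_mx a b) phi) u = cf phi (swap_expo a b u).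
Proof.
have XE i : lin_subst (tperm_mx a b) 'X_i = 'X_(tperm a b i) :> {mpoly R[3]}.
  rewrite lin_substX (bigD1 (tperm a b i)) //= !mxE eqxx scale1r big1 ?addr0 // => j.
  by rewrite !mxE eq_sym => /negbTE ->; rewrite scale0r.
have XmE m : lin_subst (tperm_mx a b) 'X_[m] =
    'X_[[multinom m (tperm a b i) | i < 3]] :> {mpoly R[3]}.
  rewrite {1}mpolyXE_id (mpolyXE _ (tperm a b)) /lin_subst rmorph_prod; apply: eq_bigr => i _ /=.
  by rewrite rmorphXn /= -/(lin_subst _ _) XE mnmE tpermK.
rewrite !cfE {1}[phi]mpolyE lin_subst_sum (big_morph _ (mcoeffD _) (mcoeff0 _ _)).
under eq_bigr => m _ do rewrite lin_substZ XmE mcoeffZ mcoeffX.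
rewrite [X in _ = X@__](mpolyE phi) (big_morph _ (mcoeffD _) (mcoeff0 _ _)).
apply: eq_bigr => m _; rewrite mcoeffZ mcoeffX; congr (_ * (nat_of_bool _)%:R).
have exE i : expo_nth u (tperm a b i) = mon (swap_expo a b u) i.
  rewrite mnmE; case: tpermP => [->|->|/eqP ia /eqP ib]; rewrite /swap_expo.
  - by clear; move: a b => [[|[|[|//]]] ?] [[|[|[|//]]] ?].
  - by clear; move: a b => [[|[|[|//]]] ?] [[|[|[|//]]] ?].
  - by move: a b i ia ib {XE XmE} => [[|[|[|//]]] ?] [[|[|[|//]]] ?] [[|[|[|//]]] ?].
apply/idP/idP => /eqP/mnmP e; apply/eqP/mnmP => i.
  by rewrite -exE; have := e (tperm a b i); rewrite !mnmE tpermK.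
by rewrite mnmE e -exE tpermK mnmE.
Qed.

Lemma supported_swap (a b : 'I_3) phi P P' : supported phi P ->
  (forall u, P (swap_expo a b u) -> P' u) -> supported (lin_subst (tperm_mx a b) phi) P'.
Proof.
move=> hP cl u hu; rewrite cf_swap hP //; apply: contra hu => /andP[du /cl ->].
rewrite andbT; apply: leq_trans du; case: u => [[i j] k]; rewrite /expo_deg /swap_expo /=.
by move: a b {cl} => [[|[|[|//]]] ?] [[|[|[|//]]] ?] /=; rewrite /expo_nth /=; lia.
Qed.

Lemma unimodular_swap (a b : 'I_3) : unimodular (tperm_mx a b : 'M[R]_3).
Proof. by rewrite /unimodular det_perm normrX normrN1 expr1n. Qed.

Lemma change_shear (a b : 'I_3) s phi : a != b -> admissible phi ->
  (admissible (lin_subst (shear a b s) phi) -> standard (lin_subst (shear a b s) phi)) ->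
  standard phi.
Proof. by move=> ab; apply: change_coords; apply: unimodular_shear. Qed.

Lemma change_swap (a b : 'I_3) phi : admissible phi ->
  (admissible (lin_subst (tperm_mx a b) phi) -> standard (lin_subst (tperm_mx a b) phi)) ->
  standard phi.
Proof. by apply: change_coords; apply: unimodular_swap. Qed.

(** Makes a coefficient nonzero by a generic shear. *)
Lemma nonroot_sum n (c : nat -> R) j : (j <= n)%N -> c j != 0 ->
  exists s, \sum_(l < n.+1) s ^+ l * c l != 0.
Proof.
move=> jn cj; pose p := \poly_(l < n.+1) c l.
have p0 : p != 0.
  by apply: contra cj => /eqP/polyP/(_ j); rewrite coef_poly ltnS jn coef0 => ->.
pose s := [seq k%:R : R | k <- iota 0 (size p)].
have us : uniq s by rewrite map_inj_uniq ?iota_uniq // => x y /eqP; rewrite eqr_nat => /eqP.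
case: (boolP (all (root p) s)) => [rs|/allPn[x _ rx]].
  by have := max_poly_roots p0 rs us; rewrite size_map size_iota ltnn.
exists x; apply: contra rx => /eqP e; rewrite /root horner_poly; apply/eqP.
by rewrite -[RHS]e; apply: eq_bigr => l _; rewrite mulrC.
Qed.

End Coordinates.

(** Such a support is preserved by all changes of y and z. *)
Definition blocks (Q : nat -> nat -> bool) : pred expo := fun u => Q u.1.1 (u.1.2 + u.2)%N.

Section Normal.
Variable R : realType.
Implicit Types (phi psi : {mpoly R[3]}) (P : pred expo) (Q : nat -> nat -> bool).

Lemma blocks_shear (a b : 'I_3) Q u l : a != ix -> b != ix -> a != b ->
  (l <= expo_nth u b)%N -> blocks Q (shift_expo a b l u) -> blocks Q u.
Proof.
case: u => [[i j] k]; rewrite /blocks /shift_expo.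
move: a b => [[|[|[|//]]] ?] [[|[|[|//]]] ?] // _ _ _; rewrite /expo_nth /= => lb.
  by rewrite (_ : (j + 1 * l - 0 * l + (k + 0 * l - 1 * l) = j + k)%N) ?mul0n ?addn0 ?subn0 //; lia.
by rewrite (_ : (j + 0 * l - 1 * l + (k + 1 * l - 0 * l) = j + k)%N) ?mul0n ?addn0 ?subn0 //; lia.
Qed.

Lemma change_zy s phi Q : admissible phi -> supported phi (blocks Q) ->
  (forall psi, admissible psi -> supported psi (blocks Q) ->
     (forall i j k, cf psi (i, j, k) =
        \sum_(l < j.+1) (s ^+ l *+ 'C(k + l, l)) * cf phi (i, j - l, k + l)%N) ->
     standard psi) -> standard phi.
Proof.
move=> adm hQ h; apply: (@change_shear _ iz iy s) => // adm'; apply: h => //.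
  by apply: supported_shear => // u l; apply: blocks_shear.
move=> i j k; rewrite (@cf_shear _ iz iy _ _ _ isT); apply: eq_bigr => l _.
by rewrite /shift_expo /expo_nth /= !mul0n !mul1n !addn0 !subn0.
Qed.

Lemma change_yz s phi Q : admissible phi -> supported phi (blocks Q) ->
  (forall psi, admissible psi -> supported psi (blocks Q) ->
     (forall i j k, cf psi (i, j, k) =
        \sum_(l < k.+1) (s ^+ l *+ 'C(j + l, l)) * cf phi (i, j + l, k - l)%N) ->
     standard psi) -> standard phi.
Proof.
move=> adm hQ h; apply: (@change_shear _ iy iz s) => // adm'; apply: h => //.
  by apply: supported_shear => // u l; apply: blocks_shear.
move=> i j k; rewrite (@cf_shear _ iy iz _ _ _ isT); apply: eq_bigr => l _.
by rewrite /shift_expo /expo_nth /= !mul0n !mul1n !addn0 !subn0.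
Qed.

(** The block (i, n) is the binary form in y and z that multiplies x^i.  If it
    is nonzero, a generic shear makes its coefficient at y^n nonzero, and a second
    one removes its coefficient at y^(n-1) z, as in the normalisation of the next to
    leading coefficient of a polynomial.  When the block is x^i times a power of a
    linear form, which is what a vanishing Hessian would say, it becomes e x^i y^n. *)
Lemma block_cases (i n : nat) Q phi : (0 < n)%N -> admissible phi -> supported phi (blocks Q) ->
  (supported phi (blocks (fun a b => Q a b && ((a, b) != (i, n)))) -> standard phi) ->
  (forall psi, admissible psi -> supported psi (blocks Q) ->
     (forall a, cf psi (a, 0, 0)%N = cf phi (a, 0, 0)%N) ->
     cf psi (i, n, 0)%N != 0 -> cf psi (i, n.-1, 1)%N = 0 -> standard psi) ->
  standard phi.
Proof.
move=> n0 adm hQ hzero hnz.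
have [/forallP z|/forallPn[j nzj]] :=
    boolP [forall j : 'I_n.+1, cf phi (i, (n - j)%N, j : nat) == 0].
  apply: hzero => -[[a b] c] hu; case: (boolP (Q a (b + c)%N)) => Qu; last first.
    by apply: hQ; rewrite /blocks /= (negbTE Qu) andbF.
  case: (boolP (expo_deg (a, b, c) <= 5)%N) => du; last by apply: hQ; rewrite (negbTE du).
  move: hu; rewrite du /blocks /= Qu /= negbK => /eqP[ai bc].
  have cn : (c < n.+1)%N by lia.
  have /= := eqP (z (Ordinal cn)); rewrite ai (_ : n - c = b)%N //; lia.
(* The coefficient at y^n after z is replaced by z + s y is a polynomial in s. *)
have [s hs] := nonroot_sum (c := fun l => cf phi (i, n - l, l)%N) (ltnSE (ltn_ord j)) nzj.
apply: (change_zy (s := s) adm hQ) => psi adm1 hQ1 cf1.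
have A1 : cf psi (i, n, 0)%N != 0.
  rewrite cf1 (eq_bigr (fun l : 'I_n.+1 => s ^+ l * cf phi (i, (n - l)%N, l : nat))) // => l _.
  by rewrite add0n binn mulr1n.
have L1 a : cf psi (a, 0, 0)%N = cf phi (a, 0, 0)%N.
  by rewrite cf1 big_ord1 expr0 bin0 mulr1n mul1r.
pose t := - cf psi (i, n.-1, 1)%N / (n%:R * cf psi (i, n, 0)%N).
apply: (change_yz (s := t) adm1 hQ1) => psi2 adm2 hQ2 cf2.
have L2 a b : cf psi2 (a, b, 0)%N = cf psi (a, b, 0)%N.
  by rewrite cf2 big_ord1 expr0 bin0 mulr1n mul1r addn0.
apply: hnz => //; [by move=> a; rewrite L2 L1 | by rewrite L2|].
rewrite cf2 !big_ord_recl big_ord0 /= expr0 bin0 mulr1n mul1r addn0 addr0.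
rewrite /bump /= expr1 addn1 prednK // bin1 -mulr_natr /t.
have nR : n%:R != 0 :> R by rewrite pnatr_eq0 -lt0n.
by field; rewrite nR A1.
Qed.

(** Divided by c3, the cubic changes sign between - M and M. *)
Lemma cubic_root (c0 c1 c2 c3 : R) : c3 != 0 ->
  exists s, c0 + c1 * s + c2 * s ^+ 2 + c3 * s ^+ 3 = 0.
Proof.
move=> c3n0; pose a := c2 / c3; pose b := c1 / c3; pose c := c0 / c3.
pose p : {poly R} := 'X ^+ 3 + a *: 'X ^+ 2 + b *: 'X + c%:P.
have pE s : p.[s] = s ^+ 3 + a * s ^+ 2 + b * s + c by rewrite !hornerE.
pose M := 1 + `|a| + `|b| + `|c|.
have ha := ler_norm a; have hb := ler_norm b; have hc := ler_norm c.
have ha' := lerNnormlW (lexx `|a|); have hb' := lerNnormlW (lexx `|b|).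
have hc' := lerNnormlW (lexx `|c|).
have M1 : 1 <= M by rewrite /M; have := normr_ge0 a; have := normr_ge0 b; have := normr_ge0 c; lra.
have [] := @poly_ivt _ p (- M) M.
- by lra.
- have Mc : M = 1 + `|a| + `|b| + `|c| by [].
  have ha0 := normr_ge0 a; have hb0 := normr_ge0 b; have hc0 := normr_ge0 c.
  rewrite !pE; move: Mc M1 ha hb hc ha' hb' hc' ha0 hb0 hc0; clear.
  move: `|a| `|b| `|c| => x y z -> {M} M1 ha hb hc ha' hb' hc' ha0 hb0 hc0.
  set M := 1 + x + y + z in M1 *.
  have M3 : M ^+ 3 = M ^+ 2 + x * M ^+ 2 + y * M ^+ 2 + z * M ^+ 2 by rewrite /M; ring.
  have MM : M <= M ^+ 2 by rewrite expr2 ler_peMr // (le_trans ler01).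
  have M0 : 1 <= M ^+ 2 by apply: le_trans MM.
  have M30 : (- M) ^+ 3 = - M ^+ 3 by ring.
  rewrite M30 sqrrN M3; move: MM M1 M0; clear M3 M30; clearbody M.
  move: M (M ^+ 2) => K N NK K1 N1.
  have aN : a * N <= x * N by apply: ler_wpM2r; lra.
  have aN' : - a * N <= x * N by apply: ler_wpM2r; lra.
  have bK : b * K <= y * N by apply: le_trans (_ : y * K <= _);
    [apply: ler_wpM2r | apply: ler_wpM2l]; lra.
  have bK' : - b * K <= y * N by apply: le_trans (_ : y * K <= _);
    [apply: ler_wpM2r | apply: ler_wpM2l]; lra.
  have cN : z <= z * N by rewrite ler_peMr.
  by apply/andP; split; lra.
move=> s _ /rootP; rewrite pE => e; exists s.
have -> : c0 + c1 * s + c2 * s ^+ 2 + c3 * s ^+ 3 = c3 * (s ^+ 3 + a * s ^+ 2 + b * s + c).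
  by rewrite /a /b /c; field.
by rewrite e mulr0.
Qed.

(** A binary cubic form has a real zero, which is moved to the z-direction. *)
Lemma cubic_zero_at_ez Q phi : admissible phi -> supported phi (blocks Q) ->
  (forall psi, admissible psi -> supported psi (blocks Q) -> cf psi (0, 0, 3)%N = 0 ->
     standard psi) ->
  standard phi.
Proof.
move=> adm hQ h; have [z|nz] := eqVneq (cf phi (0, 3, 0)%N) 0.
  apply: (@change_swap _ iy iz) => // adm'; apply: h => //; rewrite ?cf_swap //.
  by apply: supported_swap hQ _ => -[[i j] k]; rewrite /blocks /swap_expo /expo_nth /= addnC.
have [s hs] := cubic_root (cf phi (0, 0, 3)%N) (cf phi (0, 1, 2)%N) (cf phi (0, 2, 1)%N) nz.
apply: (change_yz (s := s) adm hQ) => psi adm' hQ' cf1; apply: h => //.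
rewrite cf1 -[RHS]hs !big_ord_recr big_ord0 /= !add0n !binn !mulr1n !(subSS, subn0).
by generalize_coefs; ring.
Qed.

End Normal.

Section Lead.
Variable R : realType.
Implicit Types (phi psi : {mpoly R[3]}).

Definition deg_le (d : nat) : nat -> nat -> bool := fun a b => (a + b <= d)%N.
(** The monomials x^(d-1) y and x^(d-1) z are excluded: to remove them uses up the
    freedom to shift x. *)
Definition lead_blocks (d : nat) : nat -> nat -> bool :=
  fun a b => (a + b <= d)%N && ((a, b) != (d.-1, 1%N)).

Lemma deg_le_shear (a b : 'I_3) d u l : a != b ->
  (l <= expo_nth u b)%N -> blocks (deg_le d) (shift_expo a b l u) -> blocks (deg_le d) u.
Proof.
case: u => [[i j] k]; rewrite /blocks /deg_le /shift_expo.
by move: a b => [[|[|[|//]]] ?] [[|[|[|//]]] ?] // _; rewrite /expo_nth /=; lia.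
Qed.

Lemma change_deg (a b : 'I_3) s d phi : a != b -> admissible phi ->
  supported phi (blocks (deg_le d)) ->
  (forall psi, admissible psi -> supported psi (blocks (deg_le d)) ->
     (forall u, cf psi u =
        \sum_(l < (expo_nth u b).+1)
          (s ^+ l *+ 'C(expo_nth u a + l, l)) * cf phi (shift_expo a b l u)) ->
     standard psi) -> standard phi.
Proof.
move=> ab adm hd h; apply: (change_shear ab adm) => adm'; apply: (h _ adm').
  by apply: supported_shear => // u l; apply: deg_le_shear.
by move=> u; apply: cf_shear.
Qed.

(** The direction of x is chosen such that the form of degree d does not vanish
    on it; then x is shifted by multiples of y and z to remove the
    next to leading terms. *)
Lemma lead_cases d phi : (0 < d)%N -> admissible phi -> supported phi (blocks (deg_le d)) ->
  (supported phi (blocks (deg_le d.-1)) -> standard phi) ->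
  (forall psi, admissible psi -> supported psi (blocks (lead_blocks d)) ->
     cf psi (d, 0, 0)%N != 0 -> standard psi) -> standard phi.
Proof.
move=> d0 adm hd hzero hnz.
have lead psi : admissible psi -> supported psi (blocks (deg_le d)) ->
    cf psi (d, 0, 0)%N != 0 -> standard psi.
  move=> adm1 h1 A1; have dR : d%:R != 0 :> R by rewrite pnatr_eq0 -lt0n.
  apply: (@change_deg ix iy (- cf psi (d.-1, 1, 0)%N / (d%:R * cf psi (d, 0, 0)%N)) d psi) => //.
  move=> psi2 adm2 h2 cf2.
  have A2 : cf psi2 (d, 0, 0)%N = cf psi (d, 0, 0)%N.
    by rewrite cf2 big_ord1 expr0 bin0 mulr1n mul1r /shift_expo /expo_nth /= !muln0 !addn0 !subn0.
  have B2 : cf psi2 (d.-1, 1, 0)%N = 0.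
    rewrite cf2 !big_ord_recr big_ord0 /= /shift_expo /expo_nth /= add0r.
    rewrite expr0 expr1 bin0 bin1 mulr1n mul1r !muln0 !mul0n !subn0 !addn0 muln1 addn1 prednK // subnn.
    by rewrite -mulr_natr; field; rewrite dR A1.
  apply: (@change_deg ix iz (- cf psi2 (d.-1, 0, 1)%N / (d%:R * cf psi2 (d, 0, 0)%N)) d psi2) => //.
  move=> psi3 adm3 h3 cf3.
  have L3 a b : cf psi3 (a, b, 0)%N = cf psi2 (a, b, 0)%N.
    by rewrite cf3 big_ord1 expr0 bin0 mulr1n mul1r /shift_expo /expo_nth /= !muln0 !addn0 !subn0.
  have C3 : cf psi3 (d.-1, 0, 1)%N = 0.
    rewrite cf3 !big_ord_recr big_ord0 /= /shift_expo /expo_nth /= add0r.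
    rewrite expr0 expr1 bin0 bin1 mulr1n mul1r !muln0 !mul0n !subn0 !addn0 muln1 addn1 prednK // subnn.
    by rewrite -mulr_natr; field; rewrite dR andbT; move: A1; rewrite -A2.
  apply: (hnz psi3) => //; last by rewrite L3 A2.
  move=> -[[a b] c]; case: (boolP ((a, (b + c)%N) == (d.-1, 1%N))) => [/eqP[-> bc] _|ne hu].
    have [[-> ->]|[-> ->]] : (b = 1 /\ c = 0)%N \/ (b = 0 /\ c = 1)%N by lia.
      by rewrite L3.
    exact: C3.
  by apply: h3; move: hu; rewrite /blocks /lead_blocks /= ne andbT.
have [/forallP z|/forallPn[i /forallPn[j]]] :=
    boolP [forall i : 'I_d.+1, forall j : 'I_d.+1,
             (i + j <= d)%N ==> (cf phi (i : nat, j : nat, (d - (i + j))%N) == 0)].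
  apply: hzero => -[[a b] c] hu; case: (boolP (a + b + c == d)%N) => [/eqP e|ne].
    have ad : (a < d.+1)%N by lia.
    have bd : (b < d.+1)%N by lia.
    have /forallP /(_ (Ordinal bd)) /implyP := z (Ordinal ad).
    rewrite /= (_ : d - (a + b) = c)%N; last by lia.
    by move=> h; apply/eqP/h; lia.
  by apply: hd; apply: contra hu; rewrite /blocks /deg_le /expo_deg /=; lia.
rewrite negb_imply => /andP[ij nz].
pose n := (d - i)%N.
have nz' : cf phi (i : nat, (n - (n - j))%N, (n - j)%N) != 0.
  have -> : (n - (n - j) = j)%N by rewrite /n; lia.
  by have -> : (n - j = d - (i + j))%N by rewrite /n; lia.
have [s hs] := nonroot_sum (c := fun l => cf phi (i : nat, (n - l)%N, l)) (leq_subr j n) nz'.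
apply: (change_deg (a := iz) (b := iy) (s := s) isT adm hd) => psi adm1 h1 cf1.
have A1 : cf psi (i : nat, n, 0)%N != 0.
  rewrite cf1; congr (_ != 0): hs; apply: eq_bigr => l _.
  by rewrite /= /shift_expo /expo_nth /= add0n binn mulr1n !mul0n !mul1n !addn0 !subn0 add0n.
have A1' : cf psi ((d - n)%N, n, 0)%N != 0 by have -> : (d - n = i)%N by rewrite /n; lia.
have [t ht] := nonroot_sum (c := fun l => cf psi ((d - l)%N, l, 0)%N) (leq_subr i d) A1'.
apply: (change_deg (a := iy) (b := ix) (s := t) isT adm1 h1) => psi2 adm2 h2 cf2.
apply: lead => //; rewrite cf2; congr (_ != 0): ht; apply: eq_bigr => l _.
by rewrite /= /shift_expo /expo_nth /= add0n binn mulr1n !mul0n !mul1n !addn0 !subn0 add0n.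
Qed.
End Lead.

(** * The normal form *)
Section NormalForm.
Variable R : realType.
Implicit Types (phi psi : {mpoly R[3]}) (P : pred expo).

(** The form in which positivity is exploited, in one coordinate system after the
    other. *)
Lemma posdef_diag phi : admissible phi ->
  exists mu, forall i : 'I_3, 0 < (mderiv i (mderiv i phi)).@[mu].
Proof.
move=> [_ [mu pos]]; exists mu => i.
have e0 : delta_mx i 0 != 0 :> 'cV[R]_3.
  by apply/eqP => /matrixP /(_ i 0); rewrite !mxE !eqxx => /eqP; rewrite oner_eq0.
have := pos _ e0; rewrite trmx_delta -rowE -colE !mxE.
by [].
Qed.

Lemma monE u : 'X_[mon u] = 'X_ix ^+ u.1.1 * 'X_iy ^+ u.1.2 * 'X_iz ^+ u.2 :> {mpoly R[3]}.
Proof. by rewrite mpolyXE_id !big_ord_recl big_ord0 !mnmE mulr1 mulrA. Qed.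

Definition normal_expos : seq expo :=
  [:: (0, 0, 0); (1, 0, 0); (0, 1, 0); (0, 0, 1); (2, 0, 0); (0, 2, 0); (0, 0, 2); (1, 1, 1)]%N.

Lemma lin_subst_phi0 (d : 'rV[R]_3) : lin_subst (diag_mx d) (phi0 R) =
  3%:R%:MP + ((d 0 ix) ^+ 2 *: 'X_ix ^+ 2 + (d 0 iy) ^+ 2 *: 'X_iy ^+ 2
    + (d 0 iz) ^+ 2 *: 'X_iz ^+ 2)
  + ((Num.sqrt 3%:R)^-1 * (d 0 ix * d 0 iy * d 0 iz)) *: ('X_ix * 'X_iy * 'X_iz).
Proof.
have XE i : lin_subst (diag_mx d) 'X_i = d 0 i *: 'X_i.
  rewrite lin_substX (bigD1 i) //= mxE eqxx mulr1n big1 ?addr0 // => j.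
  by rewrite mxE eq_sym => /negbTE ->; rewrite mulr0n scale0r.
rewrite /phi0 big3 !big_ord_recl big_ord0 mulr1.
rewrite !lin_substD lin_substC lin_substZ !expr2 !lin_substM !XE.
rewrite -!mul_mpolyC !mpolyCM; ring.
Qed.

(** The diagonal matrix D with entries e / sqrt(b c), 1 / sqrt(a c) and
    1 / sqrt(a b), where e = k sqrt 3 is 1 or -1: its determinant is e / (a b c), so
    dividing phi0 o D by the absolute value multiplies it by a b c. *)
Lemma standard_normal_form phi (a b c k : R) :
  supported phi (fun u => u \in normal_expos) ->
  0 < a -> 0 < b -> 0 < c -> k ^+ 2 = 1 / 3 ->
  cf phi (2, 0, 0)%N = a -> cf phi (0, 2, 0)%N = b -> cf phi (0, 0, 2)%N = c ->
  cf phi (1, 1, 1)%N = k -> cf phi (0, 0, 0)%N = 3 * a * b * c -> standard phi.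
Proof.
move=> h a0 b0 c0 k2 ea eb ec ek e0.
have [sb sc sa] : [/\ 0 < Num.sqrt b, 0 < Num.sqrt c & 0 < Num.sqrt a] by rewrite !sqrtr_gt0.
pose s3 : R := Num.sqrt 3%:R.
have s30 : 0 < s3 by rewrite sqrtr_gt0 ltr0n.
have s32 : s3 ^+ 2 = 3 by rewrite sqr_sqrtr // ler0n.
have [a2 b2 c2] : [/\ (Num.sqrt a) ^+ 2 = a, (Num.sqrt b) ^+ 2 = b & (Num.sqrt c) ^+ 2 = c].
  by rewrite !sqr_sqrtr // ltW.
move: (Num.sqrt a) (Num.sqrt b) (Num.sqrt c) sa sb sc a2 b2 c2 => x y z x0 y0 z0 ax bx cx.
pose e := k * s3.
have e2 : e ^+ 2 = 1 by rewrite /e exprMn k2 s32; field.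
pose d : 'rV[R]_3 := \row_i [:: e / (y * z); (x * z)^-1; (x * y)^-1]`_i.
have [d0 d1 d2] : [/\ d 0 ix = e / (y * z), d 0 iy = (x * z)^-1 & d 0 iz = (x * y)^-1].
  by rewrite !mxE.
have detd : \det (diag_mx d) = e / (a * b * c).
  rewrite det_diag big_ord_recl !big_ord_recl big_ord0 -/ix -/iy -/iz d0 d1 d2 -ax -bx -cx.
  by field; rewrite !gt_eqF.
have abc0 : 0 < a * b * c by rewrite !mulr_gt0.
have absd : `|\det (diag_mx d)|^-1 = a * b * c.
  rewrite detd normrM normfV (gtr0_norm abc0) (_ : `|e| = 1) ?mul1r ?invrK //.
  by apply/eqP; rewrite -(@eqrXn2 _ 2) // ?expr1n ?real_normK ?num_real ?e2.
exists (diag_mx d), (cf phi (1, 0, 0)%N *: 'X_ix + cf phi (0, 1, 0)%N *: 'X_iy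
  + cf phi (0, 0, 1)%N *: 'X_iz).
split.
- by rewrite unitmxE unitfE -normr_gt0 -invr_gt0 absd.
- by rewrite !rpredD //; apply: dhomogZ; rewrite dhomogX /= mdeg1.
rewrite absd lin_subst_phi0 d0 d1 d2 [LHS](supported_sum h).
have -> : [seq u <- low_expos | u \in normal_expos] =
  [:: (0, 0, 0); (0, 0, 1); (0, 0, 2); (0, 1, 0); (0, 2, 0); (1, 0, 0); (1, 1, 1); (2, 0, 0)]%N.
  by vm_compute.
rewrite !big_cons big_nil !monE /= ea eb ec ek e0.
have -> : (s3^-1 * (e / (y * z) * (x * z)^-1 * (x * y)^-1)) = k / (a * b * c).
  by rewrite /e -ax -bx -cx; field; rewrite !gt_eqF.
have -> : (e / (y * z)) ^+ 2 = a / (a * b * c).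
  by rewrite expr_div_n e2 -ax -bx -cx; field; rewrite !gt_eqF.
have -> : (x * z)^-1 ^+ 2 = b / (a * b * c).
  by rewrite -ax -bx -cx; field; rewrite !gt_eqF.
have -> : (x * y)^-1 ^+ 2 = c / (a * b * c).
  by rewrite -ax -bx -cx; field; rewrite !gt_eqF.
rewrite !scalerDr !scalerA ![a * b * c * (_ / _)]mulrC !divfK ?gt_eqF //.
have -> : (a * b * c) *: (3%:R)%:MP_[3] = (3 * a * b * c)%:MP.
  by rewrite -mul_mpolyC -mpolyCM; congr (_%:MP); ring.
rewrite -!mul_mpolyC !(expr0, expr1).
move: (cf phi _)%:MP (cf phi _)%:MP (cf phi _)%:MP (3 * a * b * c)%:MP a%:MP b%:MP c%:MP k%:MP.
move: 'X_ix 'X_iy 'X_iz => X Y Z l0 l1 l2 C A B E K.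
ring.
Qed.

End NormalForm.

(** * Solutions that are quadratic in x *)
Section QuadraticInX.
Variable R : realType.
Implicit Types (phi psi : {mpoly R[3]}) (P : pred expo).

Lemma supported_sub phi P P' : supported phi P ->
  all (fun u => P u ==> P' u) low_expos -> supported phi P'.
Proof.
move=> hP /allP sub u hu; apply: hP; apply: contra hu => /andP[du Pu].
by rewrite du; have := sub u; rewrite mem_low_expos Pu; apply.
Qed.

(** Boolean, so that it is checked by computation for a concrete support. *)
Definition closed_shear (a b : nat) P : bool :=
  all (fun u => all (fun l => P (shift_expo a b l u) ==> P u) (iota 0 (expo_nth u b).+1)) low_expos.

Lemma change_closed (a b : 'I_3) s P phi : a != b -> closed_shear a b P ->
  admissible phi -> supported phi P ->
  (forall psi, admissible psi -> supported psi P ->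
     (forall u, cf psi u =
        \sum_(l < (expo_nth u b).+1)
          (s ^+ l *+ 'C(expo_nth u a + l, l)) * cf phi (shift_expo a b l u)) ->
     standard psi) -> standard phi.
Proof.
move=> ab cl adm hP h; apply: (change_shear ab adm) => adm'; apply: (h _ adm').
  have hP' : supported phi (fun u => (expo_deg u <= 5)%N && P u).
    by move=> u; rewrite andbA andbb; apply: hP.
  suff : supported (lin_subst (shear a b s) phi) (fun u => (expo_deg u <= 5)%N && P u).
    by move=> h' u hu; apply: h'; rewrite andbA andbb.
  apply: (supported_shear s ab hP') => u l lb /andP[d Pu].
  have du : (expo_deg u <= 5)%N.
    apply: leq_trans d; move: lb {Pu cl hP hP' h adm adm'}; case: u => [[i j] k].
    rewrite /expo_deg /shift_expo /expo_nth /=.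
    by move: (a : nat) (b : nat) (ltn_ord a) (ltn_ord b) (ab : a != b :> nat)
      => [|[|[|//]]] [|[|[|//]]] //=; lia.
  rewrite du; move/allP: cl => /(_ u); rewrite mem_low_expos => /(_ du) /allP /(_ l).
  by rewrite mem_iota add0n ltnS lb Pu; apply.
by move=> u; apply: cf_shear.
Qed.

Definition square_expo (i : nat) : expo :=
  let f j := (if j == i then 2 else 0)%N in (f 0, f 1, f 2)%N.

(** The second derivative in X_i is then constant, twice the coefficient, and it is a
    diagonal entry of the Hessian. *)
Lemma square_coef_gt0 (i : 'I_3) P phi : admissible phi -> supported phi P ->
  all (fun u => P u ==> (2 <= expo_nth u i)%N ==> (u == square_expo i)) low_expos ->
  0 < cf phi (square_expo i).
Proof.
move=> adm hP /allP only; have [mu /(_ i)] := posdef_diag adm.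
suff -> : mderiv i (mderiv i phi) = (cf phi (square_expo i) *+ 2)%:MP by rewrite mevalC pmulrn_lgt0.
apply/mpolyP => m; have [u ->] := mon_surj m.
have mon0 : 0%MM = mon (0, 0, 0)%N by apply/mnmP; apply: ord3P; rewrite mnm0E mnmE.
rewrite !mcoeff_deriv mcoeffC mon0 (inj_eq mon_inj).
have -> : (mon u + U_(i) + U_(i))%MM = mon (expo_add u (square_expo i)).
  rewrite mon_add -addmA; congr (_ + _)%MM; apply/mnmP => j.
  rewrite mnmDE !mnm1E mnmE; move: i j {only} => [[|[|[|//]]] ?] [[|[|[|//]]] ?]; by [].
rewrite -cfE; case: eqP => [->|ne].
  rewrite mnmDE mnm1E eqxx !mnmE.
  by move: i {only} => [[|[|[|//]]] ?] /=; rewrite ?mnmE /= mulr1n mulr1.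
rewrite hP ?mul0rn ?mulr0 //; apply/negP => /andP[d Pv].
have := only (expo_add u (square_expo i)); rewrite mem_low_expos d Pv => /(_ isT).
have -> : (2 <= expo_nth (expo_add u (square_expo i)) i)%N.
  by move: i {only hP d Pv} => [[|[|[|//]]] ?]; rewrite /expo_nth /=; lia.
move=> /eqP e; apply: ne; move: e; clear d Pv; case: u => [[x y] z].
rewrite /expo_add /square_expo => -[ex0 ey0 ez0].
by have [-> -> ->] : [/\ x = 0, y = 0 & z = 0]%N by split; lia.
Qed.
End QuadraticInX.

(** The support of P + x Q + x^2 S with S affine and Q of degree at most 3. *)
Definition quadratic_blocks (a b : nat) : bool := (2 * a + b <= 5)%N.
(** The same with S constant. *)
Definition const_blocks (a b : nat) : bool := quadratic_blocks a b && ((a, b) != (2, 1)%N).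
Definition const_support (bad : seq expo) : pred expo :=
  fun u => blocks const_blocks u && (u \notin bad).

Section ConstantLeading.
Variable R : realType.
Implicit Types (phi psi : {mpoly R[3]}) (P : pred expo).

(** Here b, g and c are the coefficients at x y^3, y^4 z and y^2 z^2, while k and s are
    those at x y z and x^2.  Eliminating c leaves
    3 b^2 - 12 b k w + 32 w^2 = 0 with w = g s, a quadratic form in b and w of negative
    discriminant as k^2 = 1/3. *)
Lemma no_cubic_part (b c g k s : R) : s != 0 -> k ^+ 2 = 1 / 3 ->
  24 * (b * c * s) - 16 * (g * k * s) = 4 * b ->
  - 18 * (b * b * c) + 24 * (g * b * k) - 32 * (g * g * s) = 0 -> b = 0.
Proof.
move=> s0 k2 e1 e2; pose w := g * s.
have e : 3 * (b - 2 * k * w) ^+ 2 + 28 * w ^+ 2 = 0.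
  have -> : 3 * (b - 2 * k * w) ^+ 2 + 28 * w ^+ 2 =
    - s * (- 18 * (b * b * c) + 24 * (g * b * k) - 32 * (g * g * s))
    - 3 / 4 * b * (24 * (b * c * s) - 16 * (g * k * s) - 4 * b)
    + 12 * w ^+ 2 * (k ^+ 2 - 1 / 3) by rewrite /w; field.
  by rewrite e2 e1 k2 !subrr !mulr0 subrr addr0.
have sq1 := sqr_ge0 (b - 2 * k * w); have sq2 := sqr_ge0 w.
have w0 : w = 0 by apply/eqP; rewrite -sqrf_eq0; apply/eqP; lra.
have : (b - 2 * k * w) ^+ 2 = 0 by lra.
by rewrite w0 mulr0 subr0 => /eqP; rewrite sqrf_eq0 => /eqP.
Qed.

(** Here phi = P + x (b y^3 + k y z + const) + s x^2.  Once b = 0, the coefficient of x in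
    the equation reduces to the mixed derivative of P in y and z and kills
    the mixed terms of P; in the part without x, a term of P in y or in z alone of degree n >= 2
    requires - n (n - 1) / 3 = (n - 1)(n - 8/3), up to products with other
    such terms, and this leaves n = 2. *)
Lemma const_normalised_standard phi : admissible phi ->
  supported phi (const_support
    [:: (1, 2, 1); (1, 1, 2); (1, 0, 3); (1, 0, 2); (1, 2, 0); (1, 1, 0); (1, 0, 1)]%N) ->
  standard phi.
Proof.
move=> adm h; have NK := adm.1.
have s0 : 0 < cf phi (2, 0, 0)%N by apply: (square_coef_gt0 (i := ix) adm h); vm_compute.
have k2 : cf phi (1, 1, 1)%N ^+ 2 = 1 / 3.
  compare_coef NK h (2, 0, 0)%N e; cancel_coef (lt0r_neq0 s0) e.
have k0 : cf phi (1, 1, 1)%N != 0 by apply/eqP => k0; move: k2; rewrite k0; clear; lra.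
have ks := mulf_neq0 k0 (lt0r_neq0 s0).
have b0 : cf phi (1, 3, 0)%N = 0.
  apply/eqP/negP => /negP b0; have bs := mulf_neq0 b0 (lt0r_neq0 s0).
  vanish NK h bs (0, 3, 2)%N (1, 4, 0)%N.
  compare_coef NK h (1, 3, 0)%N e1; compare_coef NK h (0, 6, 0)%N e2; case/negP: b0; apply/eqP.
  apply: (no_cubic_part (c := cf phi (0, 2, 2)%N) (g := cf phi (0, 4, 1)%N) (lt0r_neq0 s0) k2).
    by move: e1; clear; generalize_coefs; lra.
  by move: e2; clear; generalize_coefs; lra.
have {b0}h := supported_remove h b0.
vanish NK h ks (0, 4, 1)%N (1, 3, 0)%N.
vanish NK h ks (0, 3, 2)%N (1, 2, 1)%N.
vanish NK h ks (0, 2, 3)%N (1, 1, 2)%N.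
vanish NK h ks (0, 1, 4)%N (1, 0, 3)%N.
vanish NK h ks (0, 3, 1)%N (1, 2, 0)%N.
vanish NK h ks (0, 1, 3)%N (1, 0, 2)%N.
vanish NK h ks (0, 2, 1)%N (1, 1, 0)%N.
vanish NK h ks (0, 1, 2)%N (1, 0, 1)%N.
vanish NK h ks (0, 1, 1)%N (1, 0, 0)%N.
have z22 : cf phi (0, 2, 2)%N = 0.
  have k3 : cf phi (1, 1, 1)%N * cf phi (1, 1, 1)%N ^+ 2 = cf phi (1, 1, 1)%N * (1 / 3).
    by rewrite k2.
  compare_coef NK h (1, 1, 1)%N e; apply: (mulfI ks); move: e k3; clear; generalize_coefs; lra.
have {z22}h := supported_remove h z22.
(* k^2 = 1/3 in the form in which it enters the equations below. *)
have pure u : cf phi (1, 1, 1)%N ^+ 2 * cf phi u = 1 / 3 * cf phi u by rewrite k2.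
have z50 : cf phi (0, 5, 0)%N = 0.
  have := pure (0, 5, 0)%N; compare_coef NK h (0, 5, 0)%N e; move: e; clear; generalize_coefs; lra.
have {z50}h := supported_remove h z50.
have z05 : cf phi (0, 0, 5)%N = 0.
  have := pure (0, 0, 5)%N; compare_coef NK h (0, 0, 5)%N e; move: e; clear; generalize_coefs; lra.
have {z05}h := supported_remove h z05.
have z40 : cf phi (0, 4, 0)%N = 0.
  have := pure (0, 4, 0)%N; compare_coef NK h (0, 4, 0)%N e; move: e; clear; generalize_coefs; lra.
have {z40}h := supported_remove h z40.
have z04 : cf phi (0, 0, 4)%N = 0.
  have := pure (0, 0, 4)%N; compare_coef NK h (0, 0, 4)%N e; move: e; clear; generalize_coefs; lra.
have {z04}h := supported_remove h z04.
have z30 : cf phi (0, 3, 0)%N = 0.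
  have := pure (0, 3, 0)%N; compare_coef NK h (0, 3, 0)%N e; move: e; clear; generalize_coefs; lra.
have {z30}h := supported_remove h z30.
have z03 : cf phi (0, 0, 3)%N = 0.
  have := pure (0, 0, 3)%N; compare_coef NK h (0, 0, 3)%N e; move: e; clear; generalize_coefs; lra.
have {z03}h := supported_remove h z03.
have {}h : supported phi (fun u => u \in normal_expos) by apply: (supported_sub h); vm_compute.
apply: (standard_normal_form h s0 _ _ k2 erefl erefl erefl erefl).
- by apply: (square_coef_gt0 (i := iy) adm h); vm_compute.
- by apply: (square_coef_gt0 (i := iz) adm h); vm_compute.
compare_coef NK h (0, 0, 0)%N e; move: e; clear; generalize_coefs; lra.
Qed.
End ConstantLeading.

Section Quadratic.
Variable R : realType.
Implicit Types (phi psi : {mpoly R[3]}) (P : pred expo).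

(** The quadratic formula, as 1/3 is a square. *)
Lemma isotropic (a b c : R) : c != 0 -> b ^+ 2 - 4 * a * c = 1 / 3 ->
  exists t, a + t * b + t ^+ 2 * c = 0.
Proof.
move=> c0 disc; pose d : R := Num.sqrt (1 / 3).
have d2 : d ^+ 2 = 1 / 3 by rewrite sqr_sqrtr //; lra.
exists ((d - b) / (2 * c)).
have -> : a + (d - b) / (2 * c) * b + ((d - b) / (2 * c)) ^+ 2 * c =
  (d ^+ 2 - (b ^+ 2 - 4 * a * c)) / (4 * c) by field; lra.
by rewrite d2 disc subrr mul0r.
Qed.

(** The coefficient of x is Q = b y^3 + p y^2 + k y z + linear terms.  Shears of z
    by y and of x by y and z remove p y^2 and the linear terms of Q. *)
Lemma const_isotropic_standard phi : admissible phi ->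
  supported phi (const_support [:: (1, 2, 1); (1, 1, 2); (1, 0, 3); (1, 0, 2)]%N) -> standard phi.
Proof.
move=> adm h; have NK := adm.1.
have s0 : 0 < cf phi (2, 0, 0)%N by apply: (square_coef_gt0 (i := ix) adm h); vm_compute.
have k0 : cf phi (1, 1, 1)%N != 0.
  apply/eqP => k0; compare_coef NK h (2, 0, 0)%N e.
  move: e s0; rewrite k0; clear; generalize_coefs; lra.
apply: (change_closed (a := iz) (b := iy)
  (s := - cf phi (1, 2, 0)%N / cf phi (1, 1, 1)%N) isT _ adm h); first by vm_compute.
move=> psi1 adm1 h1 cf1.
have z1 : cf psi1 (1, 2, 0)%N = 0.
  rewrite cf1 !big_ord_recr big_ord0 /= /shift_expo /expo_nth /=.
  rewrite (h (1, 0, 2)%N) // mulr0 addr0 add0r !binn expr0 expr1 !mulr1n mul1r.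
  by rewrite divfK // subrr.
have {}h1 := supported_remove h1 z1.
have s1 : 0 < cf psi1 (2, 0, 0)%N by apply: (square_coef_gt0 (i := ix) adm1 h1); vm_compute.
apply: (change_closed (a := ix) (b := iy)
  (s := - cf psi1 (1, 1, 0)%N / (cf psi1 (2, 0, 0)%N *+ 2)) isT _ adm1 h1); first by vm_compute.
move=> psi2 adm2 h2 cf2.
have z2 : cf psi2 (1, 1, 0)%N = 0.
  rewrite cf2 !big_ord_recr big_ord0 /= /shift_expo /expo_nth /=.
  rewrite add0r expr0 expr1 bin0 bin1 mulr1n mul1r mulrnAl -mulrnAr divfK ?subrr //.
  by rewrite lt0r_neq0 // pmulrn_lgt0.
have {}h2 := supported_remove h2 z2.
have s2 : 0 < cf psi2 (2, 0, 0)%N by apply: (square_coef_gt0 (i := ix) adm2 h2); vm_compute.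
apply: (change_closed (a := ix) (b := iz)
  (s := - cf psi2 (1, 0, 1)%N / (cf psi2 (2, 0, 0)%N *+ 2)) isT _ adm2 h2); first by vm_compute.
move=> psi3 adm3 h3 cf3.
have z3 : cf psi3 (1, 0, 1)%N = 0.
  rewrite cf3 !big_ord_recr big_ord0 /= /shift_expo /expo_nth /=.
  rewrite add0r expr0 expr1 bin0 bin1 mulr1n mul1r mulrnAl -mulrnAr divfK ?subrr //.
  by rewrite lt0r_neq0 // pmulrn_lgt0.
have {}h3 := supported_remove h3 z3.
by apply: const_normalised_standard adm3 _; apply: (supported_sub h3); vm_compute.
Qed.

(** The equation at x^2 says that Q, the coefficient of x, has
    Hessian determinant - 1/3.  If the cubic part of Q vanishes, the quadratic part is
    indefinite, and an isotropic vector is taken as the z-direction.  Otherwise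
    the cubic part is b y^3, and the z-direction is isotropic already. *)
Lemma const_standard phi : admissible phi -> supported phi (blocks const_blocks) -> standard phi.
Proof.
move=> adm h; apply: (block_cases (i := 1) (n := 3) isT adm h) => [h0 | psi adm1 h1 _ b0 z].
  have s0 : 0 < cf phi (2, 0, 0)%N by apply: (square_coef_gt0 (i := ix) adm h0); vm_compute.
  have disc : cf phi (1, 1, 1)%N ^+ 2 - 4 * cf phi (1, 0, 2)%N * cf phi (1, 2, 0)%N = 1 / 3.
    compare_coef adm.1 h0 (2, 0, 0)%N e; cancel_coef (lt0r_neq0 s0) e.
  have final psi : admissible psi ->
      supported psi (blocks (fun a b => const_blocks a b && ((a, b) != (1, 3)%N))) ->
      cf psi (1, 0, 2)%N = 0 -> standard psi.
    move=> adm1 h1 z; have {}h1 := supported_remove h1 z.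
    by apply: const_isotropic_standard adm1 _; apply: (supported_sub h1); vm_compute.
  have [z|nz] := eqVneq (cf phi (1, 2, 0)%N) 0.
    apply: (change_swap (a := iy) (b := iz) adm) => adm'; apply: final => //.
      by apply: supported_swap h0 _ => -[[i j] k]; rewrite /blocks /swap_expo /expo_nth /= addnC.
    by rewrite cf_swap.
  have [t ht] := isotropic nz disc.
  apply: (change_yz (s := t) adm h0) => psi adm1 h1 cf1; apply: final => //.
  rewrite cf1 -[RHS]ht !big_ord_recr big_ord0 /= !add0n !binn !mulr1n !(subSS, subn0).
  by generalize_coefs; ring.
have s0 : 0 < cf psi (2, 0, 0)%N by apply: (square_coef_gt0 (i := ix) adm1 h1); vm_compute.
have {z}h1 := supported_remove h1 z; have NK := adm1.1.
have bs := mulf_neq0 b0 (lt0r_neq0 s0).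
vanish NK h1 bs (1, 1, 2)%N (2, 2, 0)%N.
vanish NK h1 bs (1, 0, 3)%N (2, 1, 1)%N.
vanish NK h1 bs (1, 0, 2)%N (2, 1, 0)%N.
by apply: const_isotropic_standard adm1 _; apply: (supported_sub h1); vm_compute.
Qed.

(** Let n y be the linear part of S.  The equations at x^3 and x^2, and
    those at x y^4 z and y^4 z, leave only monomials such that 2 i + j + 2 k <= 5.
    This bound is symmetric in x and z, so an isotropic vector of the form
    n x^2 + c_111 x z + c_012 z^2 can replace the x-direction. *)
Lemma quadratic_standard phi :
  admissible phi -> supported phi (blocks quadratic_blocks) -> standard phi.
Proof.
move=> adm h; apply: (block_cases (i := 2) (n := 1) isT adm h) => [h0 | psi adm1 h1 _ n0 z].
  exact: const_standard adm h0.
have {z}h1 := supported_remove h1 z; have NK := adm1.1.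
have nn := mulf_neq0 n0 n0.
(* Degree 3 in x: det (x^2 S + x Q)'' leaves only - 4 n^2 x^3 d_z^2 Q. *)
vanish NK h1 nn (1, 0, 2)%N (3, 0, 0)%N.
vanish NK h1 nn (1, 0, 3)%N (3, 0, 1)%N.
vanish NK h1 nn (1, 1, 2)%N (3, 1, 0)%N.
(* Degree 2 in x: the second derivative of P in z depends on y only. *)
vanish NK h1 nn (0, 0, 3)%N (2, 0, 1)%N.
vanish NK h1 nn (0, 0, 4)%N (2, 0, 2)%N.
vanish NK h1 nn (0, 0, 5)%N (2, 0, 3)%N.
vanish NK h1 nn (0, 1, 3)%N (2, 1, 1)%N.
vanish NK h1 nn (0, 1, 4)%N (2, 1, 2)%N.
vanish NK h1 nn (0, 2, 3)%N (2, 2, 1)%N.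
vanish NK h1 nn (0, 3, 2)%N (2, 3, 0)%N.
have z : cf psi (1, 2, 1)%N = 0.
  have c3 : cf psi (1, 2, 1)%N ^+ 3 = 0.
    by compare_coef NK h1 (1, 4, 1)%N e; move: e; clear; generalize_coefs; lra.
  by move/eqP: c3; rewrite expf_eq0 => /eqP.
have {z}h1 := supported_remove h1 z.
vanish NK h1 nn (0, 2, 2)%N (2, 2, 0)%N.
have disc : cf psi (1, 1, 1)%N ^+ 2 - 4 * cf psi (0, 1, 2)%N * cf psi (2, 1, 0)%N = 1 / 3.
  compare_coef NK h1 (2, 1, 0)%N e; cancel_coef n0 e.
have z : cf psi (0, 4, 1)%N = 0.
  compare_coef NK h1 (0, 4, 1)%N e.
  have d : (cf psi (1, 1, 1)%N ^+ 2 - 4 * cf psi (0, 1, 2)%N * cf psi (2, 1, 0)%N)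
      * cf psi (0, 4, 1)%N
    = 1 / 3 * cf psi (0, 4, 1)%N by rewrite disc.
  by move: e d; clear; generalize_coefs; lra.
have {z}h1 := supported_remove h1 z.
have {}h1 : supported psi (fun u => 2 * u.1.1 + u.1.2 + 2 * u.2 <= 5)%N.
  by apply: (supported_sub h1); vm_compute.
have [t ht] := isotropic n0 disc.
apply: (change_swap (a := ix) (b := iz) adm1) => adm2.
have h2 : supported (lin_subst (tperm_mx ix iz) psi) (fun u => 2 * u.1.1 + u.1.2 + 2 * u.2 <= 5)%N.
  by apply: supported_swap h1 _ => -[[i j] k]; rewrite /swap_expo /expo_nth /=; lia.
apply: (change_closed (a := iz) (b := ix) (s := t) isT _ adm2 h2); first by vm_compute.
move=> psi3 adm3 h3 cf3.
have z : cf psi3 (2, 1, 0)%N = 0.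
  rewrite cf3 -[RHS]ht !big_ord_recr big_ord0 /= !cf_swap /shift_expo /swap_expo /expo_nth /=.
  rewrite !binn !mulr1n !(subSS, subn0, mul0n, mul1n, addn0, add0n).
  by generalize_coefs; ring.
have {z}h3 := supported_remove h3 z.
by apply: const_standard adm3 _; apply: (supported_sub h3); vm_compute.
Qed.
End Quadratic.

(** * Finding a direction in which the solution is quadratic *)
Section HighDegree.
Variable R : realType.
Implicit Types (phi psi : {mpoly R[3]}) (P : pred expo).

Definition quadratic_z : pred expo := fun u => (u.1.1 + u.1.2 + 2 * u.2 <= 5)%N.

Lemma quadratic_z_standard phi : admissible phi -> supported phi quadratic_z -> standard phi.
Proof.
move=> adm h; apply: (change_swap (a := ix) (b := iz) adm) => adm'.
apply: quadratic_standard adm' _.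
apply: supported_swap h _ => -[[i j] k].
by rewrite /quadratic_z /blocks /quadratic_blocks /swap_expo /expo_nth /=; lia.
Qed.

(** For use when z^3 is the only monomial such that i + j + 2 k > 5. *)
Lemma standard_by_cubic_zero phi Q : admissible phi -> supported phi (blocks Q) ->
  all (fun u => blocks Q u && (u != (0, 0, 3)%N) ==> quadratic_z u) low_expos -> standard phi.
Proof.
move=> adm h sub; apply: (cubic_zero_at_ez adm h) => psi adm1 h1 z.
by apply: (quadratic_z_standard adm1); apply: (supported_sub (supported_remove h1 z)).
Qed.

(** The first equations only tie a coefficient u of the leading or quartic form to
    other ones; here and in the next lemma, later equations exclude it. *)
Lemma zero_from_cube (e u v : R) : u * u = e * v -> u * v = 0 -> u = 0.
Proof.
move=> uu uv; have : u ^+ 3 = 0 by rewrite !exprS expr0 mulr1 uu mulrCA uv mulr0.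
by move/eqP; rewrite expf_eq0 => /eqP.
Qed.

Lemma zero_from_minors (e v c w : R) : e != 0 ->
  e * v = c ^+ 2 -> e * w = c * v -> v ^+ 2 + c * w = 0 -> v = 0.
Proof.
move=> e0 ev ew vw; apply/eqP; rewrite -sqrf_eq0; apply/eqP.
have e20 : 2 * e != 0 by rewrite mulf_neq0 ?pnatr_eq0.
apply: (mulfI e20); rewrite mulr0.
have -> : 2 * e * v ^+ 2 =
    e * (v ^+ 2 + c * w) - c * (e * w - c * v) + v * (e * v - c ^+ 2) by ring.
by rewrite vw ew ev !subrr !mulr0 subrr addr0.
Qed.

(** The dichotomy of block_cases when A x^d is the leading term in x; the two nonzero
    coefficients A and e occur in the equations as a factor A e. *)
Lemma leading_block_cases (d i n : nat) Q phi : (0 < n)%N ->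
  admissible phi -> supported phi (blocks Q) -> cf phi (d, 0, 0)%N != 0 ->
  (supported phi (blocks (fun a b => Q a b && ((a, b) != (i, n)))) -> standard phi) ->
  (forall psi, admissible psi -> supported psi (fun u => blocks Q u && (u != (i, n.-1, 1)%N)) ->
     cf psi (d, 0, 0)%N != 0 -> cf psi (d, 0, 0)%N * cf psi (i, n, 0)%N != 0 ->
     standard psi) -> standard phi.
Proof.
move=> n0 adm h A0 hzero hnz; apply: (block_cases n0 adm h hzero).
move=> psi adm1 h1 A1 e0 z; have {}A0 : cf psi (d, 0, 0)%N != 0 by rewrite A1.
by apply: hnz => //; [apply: supported_remove | apply: mulf_neq0].
Qed.

(** The first nonzero block e y^n x^(4-n) of the leading form after A x^4
    decides.  Ordered by decreasing powers of x, the equations of degree 6 show that the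
    leading form does not involve z, and one equation of degree 5, with the
    factor A e of the leading coefficient of the Hessian in x and y,
    that the cubic part does not involve z^3.  If the leading form is just A x^4, a
    real zero of the cubic part in the plane x = 0 serves the same purpose. *)
Lemma quartic_standard phi : admissible phi -> supported phi (blocks (lead_blocks 4)) ->
  cf phi (4, 0, 0)%N != 0 -> standard phi.
Proof.
move=> adm h A0.
apply: (leading_block_cases (d := 4) (i := 2) (n := 2) isT adm h A0)
  => [{}h | psi adm1 h1 A1 Ae]; last first.
  have NK := adm1.1.
  vanish NK h1 Ae (2, 0, 2)%N (6, 0, 0)%N.
  vanish NK h1 Ae (1, 0, 3)%N (5, 0, 1)%N.
  vanish NK h1 Ae (1, 1, 2)%N (5, 1, 0)%N.
  vanish NK h1 Ae (0, 1, 3)%N (4, 1, 1)%N.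
  vanish NK h1 Ae (0, 0, 4)%N (4, 0, 2)%N.
  have z : cf psi (1, 2, 1)%N = 0.
    apply: (zero_from_cube (e := cf psi (2, 2, 0)%N) (v := cf psi (0, 2, 2)%N)).
      by compare_coef NK h1 (4, 2, 0)%N e; cancel_coef A1 e.
    by compare_coef NK h1 (3, 2, 1)%N e; cancel_coef A1 e.
  have {z}h1 := supported_remove h1 z.
  vanish NK h1 Ae (0, 2, 2)%N (4, 2, 0)%N.
  vanish_square NK h1 A1 (0, 3, 1)%N (2, 4, 0)%N.
  vanish NK h1 Ae (0, 0, 3)%N (4, 0, 1)%N.
  by apply: (quadratic_z_standard adm1); apply: (supported_sub h1); vm_compute.
apply: (leading_block_cases (d := 4) (i := 1) (n := 3) isT adm h A0)
  => [{}h | psi adm1 h1 A1 Ae]; last first.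
  have NK := adm1.1.
  vanish NK h1 Ae (1, 1, 2)%N (4, 2, 0)%N.
  vanish NK h1 Ae (1, 0, 3)%N (4, 1, 1)%N.
  vanish NK h1 Ae (0, 2, 2)%N (3, 3, 0)%N.
  vanish NK h1 Ae (0, 1, 3)%N (3, 2, 1)%N.
  vanish NK h1 Ae (0, 0, 4)%N (3, 1, 2)%N.
  vanish_square NK h1 A1 (0, 3, 1)%N (2, 4, 0)%N.
  vanish NK h1 Ae (0, 0, 3)%N (3, 1, 1)%N.
  by apply: (quadratic_z_standard adm1); apply: (supported_sub h1); vm_compute.
apply: (leading_block_cases (d := 4) (i := 0) (n := 4) isT adm h A0)
  => [{}h | psi adm1 h1 A1 Ae]; last first.
  have NK := adm1.1.
  vanish NK h1 Ae (0, 2, 2)%N (2, 4, 0)%N.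
  vanish NK h1 Ae (0, 1, 3)%N (2, 3, 1)%N.
  vanish NK h1 Ae (0, 0, 4)%N (2, 2, 2)%N.
  vanish NK h1 Ae (0, 0, 3)%N (2, 2, 1)%N.
  by apply: (quadratic_z_standard adm1); apply: (supported_sub h1); vm_compute.
by apply: standard_by_cubic_zero adm h _; vm_compute.
Qed.

(** The leading form is A x^5.  In degree 7 the equation says that the quartic part,
    as a function of y and z, has Hessian determinant zero; its first nonzero block
    is normalised, and then the quartic part is linear in z.  In degree 6 the equation
    kills z^3.  If the quartic part is x^3 times a linear form, a real zero of the
    cubic part in the plane x = 0 is available instead. *)
Lemma power_quintic_standard phi :
  let Q a b := deg_le 5 a b && ((a + b == 5) ==> (b == 0))%N in
  admissible phi -> supported phi (blocks Q) -> cf phi (5, 0, 0)%N != 0 -> standard phi.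
Proof.
move=> Q adm h A0.
apply: (leading_block_cases (d := 5) (i := 0) (n := 4) isT adm h A0)
  => [{}h | psi adm1 h1 A1 Ae]; last first.
  have NK := adm1.1.
  vanish NK h1 Ae (0, 2, 2)%N (3, 4, 0)%N.
  vanish NK h1 Ae (0, 1, 3)%N (3, 3, 1)%N.
  vanish NK h1 Ae (0, 0, 4)%N (3, 2, 2)%N.
  vanish NK h1 Ae (1, 1, 2)%N (4, 3, 0)%N.
  vanish NK h1 Ae (1, 0, 3)%N (4, 2, 1)%N.
  have z : cf psi (1, 2, 1)%N = 0.
    apply: (zero_from_cube (e := 6 * cf psi (0, 4, 0)%N) (v := cf psi (2, 0, 2)%N)).
      by compare_coef NK h1 (5, 2, 0)%N e; cancel_coef A1 e.
    by compare_coef NK h1 (6, 0, 1)%N e; cancel_coef A1 e.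
  have {z}h1 := supported_remove h1 z.
  vanish NK h1 Ae (2, 0, 2)%N (5, 2, 0)%N.
  vanish_square NK h1 A1 (2, 1, 1)%N (7, 0, 0)%N.
  vanish NK h1 Ae (0, 0, 3)%N (3, 2, 1)%N.
  by apply: (quadratic_z_standard adm1); apply: (supported_sub h1); vm_compute.
apply: (leading_block_cases (d := 5) (i := 1) (n := 3) isT adm h A0)
  => [{}h | psi adm1 h1 A1 Ae]; last first.
  have NK := adm1.1.
  vanish NK h1 Ae (1, 1, 2)%N (5, 2, 0)%N.
  vanish NK h1 Ae (1, 0, 3)%N (5, 1, 1)%N.
  vanish NK h1 Ae (2, 0, 2)%N (6, 1, 0)%N.
  vanish_square NK h1 A1 (2, 1, 1)%N (7, 0, 0)%N.
  vanish NK h1 Ae (0, 0, 3)%N (4, 1, 1)%N.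
  by apply: (quadratic_z_standard adm1); apply: (supported_sub h1); vm_compute.
apply: (leading_block_cases (d := 5) (i := 2) (n := 2) isT adm h A0)
  => [{}h | psi adm1 h1 A1 Ae]; last first.
  have NK := adm1.1.
  vanish NK h1 Ae (2, 0, 2)%N (7, 0, 0)%N.
  vanish NK h1 Ae (0, 0, 3)%N (5, 0, 1)%N.
  by apply: (quadratic_z_standard adm1); apply: (supported_sub h1); vm_compute.
by apply: standard_by_cubic_zero adm h _; vm_compute.
Qed.

(** As for quartics, with the equations of degree 9 for the leading form, of degree 8
    for the quartic part, which must be at most linear in z, and of degree 7
    for z^3. *)
Lemma quintic_standard phi : admissible phi -> supported phi (blocks (lead_blocks 5)) ->
  cf phi (5, 0, 0)%N != 0 -> standard phi.
Proof.
move=> adm h A0.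
apply: (leading_block_cases (d := 5) (i := 3) (n := 2) isT adm h A0)
  => [{}h | psi adm1 h1 A1 Ae]; last first.
  have NK := adm1.1.
  vanish NK h1 Ae (3, 0, 2)%N (9, 0, 0)%N.
  vanish NK h1 Ae (2, 1, 2)%N (8, 1, 0)%N.
  vanish NK h1 Ae (2, 0, 3)%N (8, 0, 1)%N.
  vanish NK h1 Ae (1, 1, 3)%N (7, 1, 1)%N.
  vanish NK h1 Ae (1, 0, 4)%N (7, 0, 2)%N.
  vanish NK h1 Ae (0, 0, 5)%N (6, 0, 3)%N.
  vanish NK h1 Ae (0, 1, 4)%N (6, 1, 2)%N.
  have e0 : cf psi (3, 2, 0)%N != 0 by move: Ae; rewrite mulf_eq0 negb_or => /andP[].
  have z : cf psi (1, 2, 2)%N = 0.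
    apply: (zero_from_minors (c := cf psi (2, 2, 1)%N) (w := cf psi (0, 2, 3)%N) e0).
    - by compare_coef NK h1 (7, 2, 0)%N e; cancel_coef A1 e.
    - by compare_coef NK h1 (6, 2, 1)%N e; cancel_coef A1 e.
    - by compare_coef NK h1 (5, 2, 2)%N e; cancel_coef A1 e.
  have {z}h1 := supported_remove h1 z.
  vanish_square NK h1 A1 (2, 2, 1)%N (7, 2, 0)%N.
  vanish NK h1 Ae (0, 2, 3)%N (6, 2, 1)%N.
  vanish NK h1 Ae (0, 3, 2)%N (6, 3, 0)%N.
  vanish_square NK h1 A1 (1, 3, 1)%N (5, 4, 0)%N.
  vanish_square NK h1 A1 (0, 4, 1)%N (3, 6, 0)%N.
  (* The leading form is free of z; next, the terms of the quartic part with z^2. *)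
  vanish NK h1 Ae (2, 0, 2)%N (8, 0, 0)%N.
  vanish NK h1 Ae (1, 1, 2)%N (7, 1, 0)%N.
  vanish NK h1 Ae (1, 0, 3)%N (7, 0, 1)%N.
  vanish NK h1 Ae (0, 2, 2)%N (6, 2, 0)%N.
  vanish NK h1 Ae (0, 1, 3)%N (6, 1, 1)%N.
  vanish NK h1 Ae (0, 0, 4)%N (6, 0, 2)%N.
  vanish NK h1 Ae (0, 0, 3)%N (6, 0, 1)%N.
  by apply: (quadratic_z_standard adm1); apply: (supported_sub h1); vm_compute.
apply: (leading_block_cases (d := 5) (i := 2) (n := 3) isT adm h A0)
  => [{}h | psi adm1 h1 A1 Ae]; last first.
  have NK := adm1.1.
  vanish NK h1 Ae (2, 1, 2)%N (7, 2, 0)%N.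
  vanish NK h1 Ae (2, 0, 3)%N (7, 1, 1)%N.
  vanish NK h1 Ae (1, 2, 2)%N (6, 3, 0)%N.
  vanish NK h1 Ae (1, 1, 3)%N (6, 2, 1)%N.
  vanish NK h1 Ae (1, 0, 4)%N (6, 1, 2)%N.
  vanish NK h1 Ae (0, 1, 4)%N (5, 2, 2)%N.
  vanish NK h1 Ae (0, 0, 5)%N (5, 1, 3)%N.
  vanish NK h1 Ae (0, 2, 3)%N (5, 3, 1)%N.
  have z : cf psi (1, 3, 1)%N = 0.
    apply: (zero_from_cube (e := 4 / 3 * cf psi (2, 3, 0)%N) (v := cf psi (0, 3, 2)%N)).
      by compare_coef NK h1 (5, 4, 0)%N e; cancel_coef A1 e.
    by compare_coef NK h1 (4, 4, 1)%N e; cancel_coef A1 e.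
  have {z}h1 := supported_remove h1 z.
  vanish NK h1 Ae (0, 3, 2)%N (5, 4, 0)%N.
  vanish_square NK h1 A1 (0, 4, 1)%N (3, 6, 0)%N.
  (* The leading form is free of z; next, the terms of the quartic part with z^2. *)
  vanish NK h1 Ae (2, 0, 2)%N (7, 1, 0)%N.
  vanish NK h1 Ae (1, 1, 2)%N (6, 2, 0)%N.
  vanish NK h1 Ae (1, 0, 3)%N (6, 1, 1)%N.
  vanish NK h1 Ae (0, 2, 2)%N (5, 3, 0)%N.
  vanish NK h1 Ae (0, 1, 3)%N (5, 2, 1)%N.
  vanish NK h1 Ae (0, 0, 4)%N (5, 1, 2)%N.
  vanish NK h1 Ae (0, 0, 3)%N (5, 1, 1)%N.
  by apply: (quadratic_z_standard adm1); apply: (supported_sub h1); vm_compute.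
apply: (leading_block_cases (d := 5) (i := 1) (n := 4) isT adm h A0)
  => [{}h | psi adm1 h1 A1 Ae]; last first.
  have NK := adm1.1.
  vanish NK h1 Ae (1, 2, 2)%N (5, 4, 0)%N.
  vanish NK h1 Ae (1, 1, 3)%N (5, 3, 1)%N.
  vanish NK h1 Ae (1, 0, 4)%N (5, 2, 2)%N.
  vanish NK h1 Ae (0, 3, 2)%N (4, 5, 0)%N.
  vanish NK h1 Ae (0, 2, 3)%N (4, 4, 1)%N.
  vanish NK h1 Ae (0, 1, 4)%N (4, 3, 2)%N.
  vanish NK h1 Ae (0, 0, 5)%N (4, 2, 3)%N.
  vanish_square NK h1 A1 (0, 4, 1)%N (3, 6, 0)%N.
  (* The leading form is free of z; next, the terms of the quartic part with z^2. *)
  vanish NK h1 Ae (2, 0, 2)%N (6, 2, 0)%N.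
  vanish NK h1 Ae (1, 1, 2)%N (5, 3, 0)%N.
  vanish NK h1 Ae (1, 0, 3)%N (5, 2, 1)%N.
  vanish NK h1 Ae (0, 2, 2)%N (4, 4, 0)%N.
  vanish NK h1 Ae (0, 1, 3)%N (4, 3, 1)%N.
  vanish NK h1 Ae (0, 0, 4)%N (4, 2, 2)%N.
  vanish NK h1 Ae (0, 0, 3)%N (4, 2, 1)%N.
  by apply: (quadratic_z_standard adm1); apply: (supported_sub h1); vm_compute.
apply: (leading_block_cases (d := 5) (i := 0) (n := 5) isT adm h A0)
  => [{}h | psi adm1 h1 A1 Ae]; last first.
  have NK := adm1.1.
  vanish NK h1 Ae (0, 3, 2)%N (3, 6, 0)%N.
  vanish NK h1 Ae (0, 2, 3)%N (3, 5, 1)%N.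
  vanish NK h1 Ae (0, 1, 4)%N (3, 4, 2)%N.
  vanish NK h1 Ae (0, 0, 5)%N (3, 3, 3)%N.
  (* The leading form is free of z; next, the terms of the quartic part with z^2. *)
  vanish NK h1 Ae (2, 0, 2)%N (5, 3, 0)%N.
  vanish NK h1 Ae (1, 1, 2)%N (4, 4, 0)%N.
  vanish NK h1 Ae (1, 0, 3)%N (4, 3, 1)%N.
  vanish NK h1 Ae (0, 2, 2)%N (3, 5, 0)%N.
  vanish NK h1 Ae (0, 1, 3)%N (3, 4, 1)%N.
  vanish NK h1 Ae (0, 0, 4)%N (3, 3, 2)%N.
  vanish NK h1 Ae (0, 0, 3)%N (3, 3, 1)%N.
  by apply: (quadratic_z_standard adm1); apply: (supported_sub h1); vm_compute.
by apply: (power_quintic_standard adm _ A0); apply: (supported_sub h); vm_compute.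
Qed.

End HighDegree.

Theorem theorem1p3 (R : realType) (phi : {mpoly R[3]})
  (deg_phi : (msize phi <= 6)%N)
  (sol_phi : toric_NK_equation phi)
  (pos_phi : exists mu : 'I_3 -> R, hess_posdef_at phi mu) :
  toric_NK_equiv phi (phi0 R).
Proof.
have adm : admissible phi by [].
have h5 : supported phi (blocks (deg_le 5)).
  move=> u hu; apply: memN_msupp_eq0; apply: msize_mdeg_ge; apply: leq_trans deg_phi _.
  by rewrite mdeg_mon; move: hu; rewrite /blocks /deg_le /expo_deg; lia.
apply: (lead_cases _ adm h5) => // [h4 | psi adm1]; last exact: quintic_standard.
apply: (lead_cases _ adm h4) => // [h3 | psi adm1]; last exact: quartic_standard.
by apply: (standard_by_cubic_zero adm h3); vm_compute.
Qed.
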